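(* Let $\Lambda\subset\mathbb{C}$ be a regular self-similar arc generated by a basic figure with vertices $z_0=0,z_1,\dots,z_\ell=1$, and let $s=\dim_H(\Lambda)$. Suppose that $1\le p\le\ell-1$ and $\theta_p=0$. Then $\Lambda$ satisfies Condition $W_p$ if and only if $$(\lambda^j+\mu^k)^s=o(|\alpha\lambda^j-\beta\mu^k|),\quad j,k=0,1,2,\dots,$$ i.e. for each $\varepsilon>0$ there is $\delta>0$ such that $(\lambda^j+\mu^k)^s\le\varepsilon|\alpha\lambda^j-\beta\mu^k|$ for all integers $j,k\ge0$ with $|\alpha\lambda^j-\beta\mu^k|<\delta$. Here, with $r_i$ the ratio of $S_i$, $\lambda=r_\ell$, $\mu=r_1$, $\alpha=r_p|1-z_q|$, $\beta=r_{p+1}|z_q|$.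
   Context: Identify $\mathbb{R}^2$ with $\mathbb{C}$. Basic figures. Let $\Omega$ be a polygon formed by a sequence of successive segments in the plane, with $\ell+1$ vertices $z_0,z_1,\dots,z_\ell$, such that $z_1,z_{\ell-1}$ lie on the segment $\overline{z_0z_\ell}$ and $z_{\ell-1}$ lies on the segment $\overline{z_1z_\ell}$. Suppose there is a vertex $z_q$ such that all vertices belong to $\Pi=\{z_q\}\cup\overline{z_0z_\ell}\cup\Pi_0$, where $\Pi_0$ is the interior of the triangle $z_0z_\ell z_q$; let $\Pi_1$ be the closure of $\Pi_0$. For $j=1,\dots,\ell$ let $S_j$ be the unique orientation-preserving similitude (of the form $z\mapsto az+b$) with $S_j(z_0)=z_{j-1}$, $S_j(z_\ell)=z_j$; its ratio is $r_j=|a|$. $\Omega$ is a basic figure if moreover: the $S_j$ are contractive; the sets $S_j(\Pi_0)$ are pairwise disjoint; $S_j(z_q)\in\Pi_1$ for all $j$; and $S_j(\Pi_1)\cap(\overline{z_qz_0}\cup\overline{z_qz_\ell})=\emptyset$ for $j\notin\{1,\ell,q,q+1\}$. Standing assumptions: $z_0=0$, $z_\ell=1$, $\operatorname{Im}z_q>0$. Angles (all arguments in $[0,2\pi)$). Corner angle at $z_p$, $1\le p\le\ell-1$: $\theta_p=\arg\frac{S_p(z_q)-z_p}{S_{p+1}(z_q)-z_p}$. Put $\theta_{\min}=\min_p\theta_p$, $\eta_1=\arg\frac{S_q(z_q)-z_q}{z_0-z_q}$, $\eta_2=\arg\frac{z_\ell-z_q}{S_{q+1}(z_q)-z_q}$,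 $\eta_0=\min(\eta_1,\eta_2)$. The characteristic angle is $\xi=\theta_{\min}+\eta_0$. Regular self-similar arcs. Let $\Lambda$ be the unique nonempty compact set with $\Lambda=\bigcup_{j=1}^\ell S_j(\Lambda)$. If $\Lambda$ is an arc (homeomorphic to $[0,1]$), it is called the self-similar arc generated by $\Omega$; it is ordered ($\prec$, $\preceq$) from $z_0$ to $z_\ell$, and $S_j(\Lambda)$ is its subarc from $z_{j-1}$ to $z_j$. A regular self-similar arc is a self-similar arc generated by a basic figure with positive characteristic angle. Let $H^s$ be $s$-dimensional Hausdorff measure, $[x,y]$ the subarc of $\Lambda$ from $x$ to $y$ (for $x\preceq y$), and $f(x)=H^s([z_0,x])$. $\Lambda$ satisfies Condition $W_p$ if for each $\varepsilon>0$ there is $\mu_p>0$ such that $|f(x)-f(y)|\le\varepsilon|x-y|$ whenever $x,y\in\Lambda$, $z_{p-1}\preceq x\preceq z_p\preceq y\preceq z_{p+1}$ and $|x-y|<\mu_p$. *)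

(* Defs.v *)
From HB Require Import structures.
From mathcomp Require Import all_boot all_order all_algebra.
From mathcomp Require Import all_classical all_reals all_analysis.
From mathcomp Require Import complex.
Import Order.TTheory GRing.Theory Num.Theory.
Import numFieldNormedType.Exports.

Set Implicit Arguments.
Unset Strict Implicit.
Unset Printing Implicit Defensive.

Local Open Scope classical_set_scope.
Local Open Scope complex_scope.
Local Open Scope ring_scope.

(* The norm `|w| of w : R[i] is itself a (real) element of R[i]; this is the
   modulus as an element of R. *)
Notation modulus := ComplexField.Normc.normc.

(* The usual topology of the complex plane: that of the norm of the field
   R[i], which R[i]^o already carries. *)
HB.instance Definition _ (R : realType) := NormedModule.copy R[i] R[i]^o.

Section Plane.
Variable R : realType.
Implicit Types a b c w : R[i].

(* The argument in [0, 2 pi[; it is meaningless for w = 0, where every t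
   satisfies the defining equation. *)
Definition arg w : R :=
  xget 0 [set t : R | (0 <= t < 2 * pi) /\
                      w = (modulus w)%:C * (cos t +i* sin t)].

Definition segment a b : set R[i] :=
  [set w | exists t : R, (0 <= t <= 1) /\ w = a + t%:C * (b - a)].

Definition triangle a b c : set R[i] :=
  [set w | exists t u v : R,
     [/\ 0 <= t, 0 <= u, 0 <= v & t + u + v = 1] /\
     w = t%:C * a + u%:C * b + v%:C * c].

End Plane.

(* The vertices z_0, ..., z_l are the entries z`_0, ..., z`_l of a tuple. *)

Section BasicFigure.
Variables (R : realType) (l : nat) (z : l.+1.-tuple R[i]).

(* S_j, for 1 <= j <= l, maps z_0 to z_(j-1) and z_l to z_j. *)
Definition sim_coef (j : nat) : R[i] := (z`_j - z`_j.-1) / (z`_l - z`_0).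

Definition sim (j : nat) (w : R[i]) : R[i] :=
  sim_coef j * (w - z`_0) + z`_j.-1.

Definition sim_ratio (j : nat) : R := modulus (sim_coef j).

Definition Pi0 (q : nat) : set R[i] := (triangle z`_0 z`_l z`_q)°.

Definition Pi1 (q : nat) : set R[i] := closure (Pi0 q).

Record basic_figure (q : nat) : Prop := BasicFigure {
  apex_index : (q <= l)%N;
  first_on_base : segment z`_0 z`_l z`_1;
  last_on_base : segment z`_0 z`_l z`_l.-1;
  base_ordered : segment z`_1 z`_l z`_l.-1;
  vertices_in_Pi : forall j, (j <= l)%N ->
    ([set z`_q] `|` segment z`_0 z`_l `|` Pi0 q) z`_j;
  (* positivity of the ratio: each S_j is a genuine similitude *)
  sim_contractive : forall j, (1 <= j <= l)%N -> 0 < sim_ratio j < 1;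
  Pi0_disjoint : forall j k, (1 <= j <= l)%N -> (1 <= k <= l)%N -> j <> k ->
    (sim j @` Pi0 q) `&` (sim k @` Pi0 q) = set0;
  apex_in_Pi1 : forall j, (1 <= j <= l)%N -> Pi1 q (sim j z`_q);
  Pi1_off_sides : forall j, (1 <= j <= l)%N -> j \notin [:: 1; l; q; q.+1]%N ->
    (sim j @` Pi1 q) `&` (segment z`_q z`_0 `|` segment z`_q z`_l) = set0
}.

Variable q : nat.

Definition corner_angle (p : nat) : R :=
  arg ((sim p z`_q - z`_p) / (sim p.+1 z`_q - z`_p)).

(* The default value theta_1 of the iterated minimum is one of the angles
   as soon as 2 <= l. *)
Definition theta_min : R :=
  \big[Num.min/corner_angle 1]_(1 <= p < l) corner_angle p.

Definition eta1 : R := arg ((sim q z`_q - z`_q) / (z`_0 - z`_q)).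

Definition eta2 : R := arg ((z`_l - z`_q) / (sim q.+1 z`_q - z`_q)).

Definition eta0 : R := Num.min eta1 eta2.

Definition characteristic_angle : R := theta_min + eta0.

End BasicFigure.

Section Arcs.
Variable R : realType.
Implicit Types (a b x y : R[i]) (Lam : set R[i]).

(* g is a homeomorphism from [0, 1] onto Lam, with g 0 = a and g 1 = b. *)
Definition arc_param a b Lam (g : R -> R[i]) : Prop :=
  [/\ set_bij `[0, 1] Lam g,
      {within `[0, 1], continuous g},
      (exists h : R[i] -> R,
         {within Lam, continuous h} /\ {in `[0, 1], cancel g h}),
      g 0 = a & g 1 = b].

(* The order of the arc Lam, oriented from a to b; it does not depend on the
   parametrization. *)
Definition arc_le a b Lam x y : Prop :=
  exists2 g, arc_param a b Lam g &
    exists t u : R, 0 <= t /\ t <= u /\ u <= 1 /\ x = g t /\ y = g u.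

Definition subarc a b Lam x y : set R[i] :=
  [set w | arc_le a b Lam x w /\ arc_le a b Lam w y].

Definition attractor (l : nat) (z : l.+1.-tuple R[i]) Lam : Prop :=
  [/\ Lam !=set0, compact Lam &
      Lam = \bigcup_(j in [set j | (1 <= j <= l)%N]) (sim z j @` Lam)].

Definition self_similar_arc (l : nat) (z : l.+1.-tuple R[i]) Lam : Prop :=
  attractor z Lam /\ exists g, arc_param z`_0 z`_l Lam g.

Definition regular_self_similar_arc
    (l : nat) (z : l.+1.-tuple R[i]) (q : nat) Lam : Prop :=
  [/\ basic_figure z q, self_similar_arc z Lam &
      0 < characteristic_angle z q].

End Arcs.

Section Hausdorff.
Variable R : realType.
Implicit Types (A U : set R[i]) (s d : R).
Local Open Scope ereal_scope.

Definition diam U : \bar R :=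
  ereal_sup [set (modulus (x - y))%:E | x in U & y in U].

(* (diam U)^s, with value 0 at U = set0 even if s = 0 *)
Definition diam_pow s U : \bar R :=
  if U == set0 then 0 else poweR (diam U) s.

Definition hausdorff_premeasure s d A : \bar R :=
  ereal_inf [set \sum_(0 <= i <oo) diam_pow s (U i) |
    U in [set U : (set R[i])^nat |
            A `<=` \bigcup_i U i /\ forall i, diam (U i) <= d%:E]].

Definition hausdorff_measure s A : \bar R :=
  ereal_sup [set hausdorff_premeasure s d A | d in [set d : R | (0 < d)%R]].

Definition hausdorff_dim A : \bar R :=
  ereal_inf [set s%:E | s in [set s : R |
    (0 <= s)%R /\ hausdorff_measure s A = 0]].

End Hausdorff.

Definition condition_W (R : realType) (l : nat) (z : l.+1.-tuple R[i])
    (Lam : set R[i]) (s : R) (p : nat) : Prop :=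
  let le := arc_le z`_0 z`_l Lam in
  let f x := hausdorff_measure s (subarc z`_0 z`_l Lam z`_0 x) in
  forall eps : R, 0 < eps -> exists2 mu : R, 0 < mu &
    forall x y : R[i], Lam x -> Lam y ->
      le z`_p.-1 x -> le x z`_p -> le z`_p y -> le y z`_p.+1 ->
      modulus (x - y) < mu ->
      (`|f x - f y| <= (eps * modulus (x - y))%:E)%E.

(* (lam^j + mu^k)^s = o(|alpha lam^j - beta mu^k|), j, k = 0, 1, 2, ... *)
Definition little_o_condition (R : realType)
    (alpha beta lam mu s : R) : Prop :=
  forall eps : R, 0 < eps -> exists2 delta : R, 0 < delta &
    forall j k : nat, `|alpha * lam ^+ j - beta * mu ^+ k| < delta ->
      (lam ^+ j + mu ^+ k) `^ s
        <= eps * `|alpha * lam ^+ j - beta * mu ^+ k|.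

(* Main.v *)
(* The open set condition for Pi_0 gives Moran's equation sum_j r_j^s = 1 and
   0 < H^s(Lam) < oo.  Since theta_p = 0, the triangles S_p(Pi_1) and
   S_(p+1)(Pi_1) lie on opposite sides of a common ray issued from z_p, and the
   points S_p S_l^j (z_q) and S_(p+1) S_1^k (z_q) lie on that ray, at distances
   alpha lam^j and beta mu^k from z_p.  The measure of the subarc between these
   two points is comparable to (lam^j + mu^k)^s, so that Condition W_p at these
   points is the little-o condition.  Conversely, as theta_min <= 0, a positive
   characteristic angle forces eta_1, eta_2 > 0; hence outside S_l(Lam)
   (resp. S_1(Lam)) the arc leaves z_q within a cone transversal to the side from
   z_q to 1 (resp. to 0).  So if x in S_p S_l^j (Lam) and y in S_(p+1) S_1^k (Lam)
   are at levels j and k, their distances to the corresponding points of the ray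
   are O(|x - y|), therefore |alpha lam^j - beta mu^k| = O(|x - y|), and the
   little-o condition implies W_p. *)

Require Import Defs.
From mathcomp Require Import all_boot all_order all_algebra.
From mathcomp Require Import all_classical all_reals all_analysis.
From mathcomp Require Import complex.
From mathcomp Require Import finmap ring lra zify.
Import Order.TTheory GRing.Theory Num.Theory.
Import numFieldNormedType.Exports.

Set Implicit Arguments.
Unset Strict Implicit.
Unset Printing Implicit Defensive.

Local Open Scope classical_set_scope.
Local Open Scope complex_scope.
Local Open Scope ring_scope.

(** * The modulus and the topology of the complex plane *)

Section ComplexNorm.
Variable R : realType.
Implicit Types x y w : R[i].

(** Of [hausdorff_measure] only monotonicity, finite subadditivity and scaling under similitudes are
    used, so upper bounds on masses of subarcs come directly while lower bounds have to be earned.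
    They come from Moran's equation: if the sets S_j(B_j) cover A, the mass of A is at most the sum
    of the r_j^s times the masses of the B_j, and the mass of Lam is that same sum with every B_j
    replaced by Lam; hence what A lacks of the full mass is at least r_j^s times what any single B_j
    lacks. The same deficit argument settles the order of the pieces. That S_j(Lam) runs from
    z_(j-1) to z_j in the order of the arc is not part of the definition; it holds because otherwise
    a small cylinder of one piece would lie inside the next piece and could be deleted from the
    cover. Positivity of H^s avoids a limit measure: masses at a finite depth are enough, since
    compactness reduces every cover to a finite one. *)

Lemma normc_ge0 w : 0 <= modulus w.
Proof. by case: w => a b; rewrite /modulus sqrtr_ge0. Qed.

Lemma normC_normc w : `|w| = (modulus w)%:C.
Proof. by case: w => a b; rewrite normc_def. Qed.

Lemma normcD w1 w2 : modulus (w1 + w2) <= modulus w1 + modulus w2.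
Proof. exact: le_normcD. Qed.

Lemma normcN w : modulus (- w) = modulus w.
Proof. exact: complex.normcN. Qed.

Lemma normcM w1 w2 : modulus (w1 * w2) = modulus w1 * modulus w2.
Proof. exact: ComplexField.Normc.normcM. Qed.

Lemma normcV w : modulus w^-1 = (modulus w)^-1.
Proof. exact: ComplexField.Normc.normcV. Qed.

Lemma normc0 : modulus (0 : R[i]) = 0.
Proof. exact: ComplexField.Normc.normc0. Qed.

Lemma normc1 : modulus (1 : R[i]) = 1.
Proof. exact: ComplexField.Normc.normc1. Qed.

Lemma normc_eq0 w : (modulus w == 0) = (w == 0).
Proof.
apply/eqP/eqP => [|->]; last exact: normc0.
exact: ComplexField.Normc.eq0_normc.
Qed.

Lemma normc_gt0 w : (0 < modulus w) = (w != 0).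
Proof. by rewrite lt_def normc_eq0 normc_ge0 andbT. Qed.

Lemma normc_real (t : R) : modulus t%:C = `|t|.
Proof. by rewrite /modulus /= expr0n addr0 sqrtr_sqr. Qed.

Lemma normc_distC x y : modulus (x - y) = modulus (y - x).
Proof. by rewrite -normcN opprB. Qed.

Lemma normc_distD y x w : modulus (x - w) <= modulus (x - y) + modulus (y - w).
Proof. by apply: le_trans (normcD _ _); rewrite addrA subrK. Qed.

Lemma normc_Re w : `|complex.Re w| <= modulus w.
Proof.
case: w => a b; rewrite /modulus /= -sqrtr_sqr ler_wsqrtr //.
by rewrite lerDl sqr_ge0.
Qed.

Lemma normc_Im w : `|complex.Im w| <= modulus w.
Proof.
case: w => a b; rewrite /modulus /= -sqrtr_sqr ler_wsqrtr //.
by rewrite lerDr sqr_ge0.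
Qed.

Lemma normc_le_ReIm w : modulus w <= `|complex.Re w| + `|complex.Im w|.
Proof.
case: w => a b; rewrite /modulus /=.
rewrite -[leRHS]ger0_norm ?addr_ge0 // -sqrtr_sqr ler_wsqrtr //.
rewrite sqrrD !real_normK ?num_real // addrAC lerDl.
by rewrite mulrn_wge0 // mulr_ge0.
Qed.

Lemma ImD w1 w2 : complex.Im (w1 + w2) = complex.Im w1 + complex.Im w2.
Proof. by case: w1 => ? ?; case: w2. Qed.

Lemma ReD w1 w2 : complex.Re (w1 + w2) = complex.Re w1 + complex.Re w2.
Proof. by case: w1 => ? ?; case: w2. Qed.

Lemma ImRl (t : R) w : complex.Im (t%:C * w) = t * complex.Im w.
Proof. by case: w => a b /=; rewrite mul0r addr0. Qed.

Lemma ReRl (t : R) w : complex.Re (t%:C * w) = t * complex.Re w.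
Proof. by case: w => a b /=; rewrite mul0r subr0. Qed.

(** A positive element of [R[i]] is real, so the balls of the field norm are exactly those with
    radius in [R]. *)
Lemma nbhs_normcP x (A : set R[i]) :
  nbhs x A <->
  exists2 e : R, 0 < e & forall y, modulus (x - y) < e -> A y.
Proof.
split=> [/nbhs_ballP[e /= e0 xA]|[e e0 xA]].
- have /complex_realP[e' ee'] : e \is Num.real by exact: gtr0_real.
  rewrite ee' ltcR in e0.
  exists e' => // y xy; apply: xA.
  by rewrite -ball_normE /= normC_normc ee' ltcR.
- apply/nbhs_ballP; exists e%:C; first by rewrite /= ltcR.
  by move=> y; rewrite -ball_normE /= normC_normc ltcR; exact: xA.
Qed.

Lemma interior_normcP (A : set R[i]) x :
  A° x <-> exists2 e : R, 0 < e & forall y, modulus (x - y) < e -> A y.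
Proof. exact: nbhs_normcP. Qed.

Lemma closure_normcP (A : set R[i]) x :
  closure A x <->
  forall e : R, 0 < e -> exists2 y, A y & modulus (x - y) < e.
Proof.
split=> [cA e e0|cA B /nbhs_normcP[e e0 xB]].
- have /cA[y [Ay xy]] : nbhs x [set y | modulus (x - y) < e].
    by apply/nbhs_normcP; exists e.
  by exists y.
- have [y Ay xy] := cA _ e0; exists y; split => //; exact: xB.
Qed.

Lemma open_normc_ball x (e : R) : open [set y | modulus (x - y) < e].
Proof.
rewrite openE => y /= xy; apply/nbhs_normcP.
exists (e - modulus (x - y)); first by rewrite subr_gt0.
move=> w yw /=; apply: le_lt_trans (normc_distD y _ _) _.
by rewrite addrC -ltrBrDr.
Qed.

Lemma compact_normc_bounded (A : set R[i]) :
  compact A -> exists2 B : R, 0 < B & forall x, A x -> modulus x <= B.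
Proof.
move=> cA.
have := cA; rewrite compact_cover => /(_ nat setT
  (fun n => [set y | modulus (0 - y) < n%:R]))[].
- by move=> n _; exact: open_normc_ball.
- move=> x _; exists (Num.truncn (modulus x)).+1 => //=.
  by rewrite sub0r normcN truncnS_gt.
- move=> D _ AD.
(* The sum of the finitely many radii bounds each of them; adding 1 keeps it positive even for an
   empty subcover. *)
exists (\sum_(i <- D) (i%:R : R) + 1) => [|x /AD[i /= iD]].
  by rewrite ltr_pwDr // sumr_ge0.
rewrite sub0r normcN => /ltW /le_trans; apply.
rewrite (big_fsetD1 i) //= -addrA lerDl addr_ge0 // sumr_ge0 //.
Qed.

Lemma within_continuous_normcP (A : set R[i]) (h : R[i] -> R) :
  {within A, continuous h} ->
  forall x, A x -> forall e : R, 0 < e -> exists2 d : R, 0 < d &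
    forall y, A y -> modulus (x - y) < d -> `|h x - h y| < e.
Proof.
move=> /subspace_continuousP hc x Ax e e0.
have /cvgrPdist_lt/(_ _ e0) := hc x Ax.
rewrite near_withinE => /nbhs_normcP[d d0 xd].
by exists d => // y Ay xy; exact: xd.
Qed.

Lemma within_continuous_itv_normcP (a b : R) (g : R -> R[i]) :
  {within `[a, b], continuous g} <->
  forall t, t \in `[a, b] -> forall e : R, 0 < e -> exists2 d : R, 0 < d &
    forall u, u \in `[a, b] -> `|t - u| < d -> modulus (g t - g u) < e.
Proof.
split=> [/subspace_continuousP gc t tab e e0|gc].
- have [] := gc t tab [set w | modulus (g t - w) < e].
    by apply/nbhs_normcP; exists e.
  by move=> d d0 td; exists d => // u uab tu; exact: td.
- apply/subspace_continuousP => t tab B /nbhs_normcP[e e0 gtB].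
  have [d d0 td] := gc t tab e e0.
  exists d => //= u tu uab; apply: gtB; exact: td.
Qed.

End ComplexNorm.

(** * Hausdorff measure *)

Section HausdorffTheory.
Variable R : realType.
Implicit Types (A B U : set R[i]) (s d r : R).
Local Open Scope ereal_scope.

Lemma diam_le d U :
  (forall x y, U x -> U y -> (modulus (x - y) <= d)%R) -> diam U <= d%:E.
Proof.
move=> Ud; apply: ge_ereal_sup => _ [x Ux [y Uy <-]].
by rewrite lee_fin Ud.
Qed.

Lemma le_diam U x y : U x -> U y -> (modulus (x - y))%:E <= diam U.
Proof. by move=> Ux Uy; apply: ereal_sup_ubound; exists x => //; exists y. Qed.

Lemma diam_ge0 U x : U x -> 0 <= diam U.
Proof. by move=> Ux; have := le_diam Ux Ux; rewrite subrr normc0. Qed.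

Lemma diam_set0 : diam (set0 : set R[i]) = -oo.
Proof.
rewrite /diam [X in ereal_sup X](_ : _ = set0) ?ereal_sup0 //.
by apply/seteqP; split => // ? [].
Qed.

Lemma diam_pow_ge0 s U : 0 <= diam_pow s U.
Proof. by rewrite /diam_pow; case: ifP => // _; exact: poweR_ge0. Qed.

Lemma diam_pow_set0 s : diam_pow s (set0 : set R[i]) = 0.
Proof. by rewrite /diam_pow eqxx. Qed.

Lemma diam_powE s U x : U x -> diam_pow s U = (diam U) `^ s.
Proof. by move=> Ux; rewrite /diam_pow ifF//; apply/negbTE/set0P; exists x. Qed.

Lemma diam_image (f : R[i] -> R[i]) r U : (0 < r)%R ->
  (forall x y, (modulus (f x - f y) <= r * modulus (x - y))%R) ->
  diam (f @` U) <= r%:E * diam U.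
Proof.
move=> r0 fr; apply: ge_ereal_sup => _ [_ [x Ux <-] [_ [y Uy <-] <-]].
apply: (@le_trans _ _ (r%:E * (modulus (x - y))%:E)); first by rewrite lee_fin.
by rewrite lee_pmul2l// ?lte_fin//; exact: le_diam.
Qed.

Lemma diam_pow_image (f : R[i] -> R[i]) s r U : (0 <= s)%R -> (0 < r)%R ->
  (forall x y, (modulus (f x - f y) <= r * modulus (x - y))%R) ->
  diam_pow s (f @` U) <= (r `^ s)%:E * diam_pow s U.
Proof.
move=> s0 r0 fr; have [->|/set0P[x Ux]] := eqVneq U set0.
  by rewrite image_set0 diam_pow_set0 mule0.
have fU : (f @` U) (f x) by exists x.
rewrite (diam_powE _ fU) (diam_powE _ Ux).
rewrite -poweR_EFin -poweRM ?lee_fin ?(ltW r0)//; last exact: diam_ge0 Ux.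
apply: gt0_ler_poweR => //.
- by rewrite in_itv/= leey andbT; exact: diam_ge0 fU.
- by rewrite in_itv/= leey andbT mule_ge0 ?lee_fin ?(ltW r0)//; exact: diam_ge0 Ux.
- exact: diam_image.
Qed.

Lemma premeasure_le_cover s d A (U : (set R[i])^nat) :
  A `<=` \bigcup_i U i -> (forall i, diam (U i) <= d%:E) ->
  hausdorff_premeasure s d A <= \sum_(0 <= i <oo) diam_pow s (U i).
Proof. by move=> AU Ud; apply: ereal_inf_lbound; exists U. Qed.

Lemma premeasure_ge0 s d A : 0 <= hausdorff_premeasure s d A.
Proof.
apply: le_ereal_inf_tmp => _ [U _ <-].
by apply: nneseries_ge0 => *; exact: diam_pow_ge0.
Qed.

Lemma hausdorff_ge0 s A : 0 <= hausdorff_measure s A.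
Proof.
apply: le_ereal_sup_tmp; exists (hausdorff_premeasure s 1 A).
  by exists 1%R => //=.
exact: premeasure_ge0.
Qed.

Lemma premeasure_le_hausdorff s d A : (0 < d)%R ->
  hausdorff_premeasure s d A <= hausdorff_measure s A.
Proof. by move=> d0; apply: ereal_sup_ubound; exists d. Qed.

Lemma premeasure_mono s d A B : A `<=` B ->
  hausdorff_premeasure s d A <= hausdorff_premeasure s d B.
Proof.
move=> AB; apply: ereal_inf_le_tmp => _ [U [BU Ud] <-].
by exists U => //; split => //; exact: subset_trans BU.
Qed.

Lemma premeasure_anti s d d' A : (d <= d')%R ->
  hausdorff_premeasure s d' A <= hausdorff_premeasure s d A.
Proof.
move=> dd'; apply: ereal_inf_le_tmp => _ [U [BU Ud] <-].
exists U => //; split => // i; apply: le_trans (Ud i) _.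
by rewrite lee_fin.
Qed.

Lemma hausdorff_mono s A B : A `<=` B ->
  hausdorff_measure s A <= hausdorff_measure s B.
Proof.
move=> AB; apply: ge_ereal_sup => _ [d d0 <-].
by apply: le_trans (premeasure_mono _ _ AB) _; exact: premeasure_le_hausdorff.
Qed.

Lemma premeasure_diam s d A : diam A <= d%:E ->
  hausdorff_premeasure s d A <= diam_pow s A.
Proof.
move=> Ad.
(* Padding by empty sets is free: their diameter is [-oo], below every mesh, and their [diam_pow] is
   0. *)
have := @premeasure_le_cover s d A (fun i => if i == 0%N then A else set0).
rewrite (_ : \sum_(0 <= i <oo) _ = diam_pow s A); last first.
  rewrite nneseries_recl//; last by move=> *; exact: diam_pow_ge0.
  by rewrite eseries0 ?adde0// => -[//|i] _ _; rewrite diam_pow_set0.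
apply; first by move=> x Ax; exists 0%N.
by case=> [|i] //=; rewrite diam_set0 leNye.
Qed.

Lemma premeasure_set0 s d : hausdorff_premeasure s d set0 = 0.
Proof.
apply/eqP; rewrite eq_le premeasure_ge0 andbT -(diam_pow_set0 s).
by apply: premeasure_diam; rewrite diam_set0 leNye.
Qed.

Lemma hausdorff_set0 s : hausdorff_measure s set0 = 0.
Proof.
apply/eqP; rewrite eq_le hausdorff_ge0 andbT.
by apply: ge_ereal_sup => _ [d _ <-]; rewrite premeasure_set0.
Qed.

(** Two countable covers are merged into one by alternation; this inequality is all that
    subadditivity needs. *)
Lemma nneseries_interleave (u v : (\bar R)^nat) :
  (forall n, 0 <= u n) -> (forall n, 0 <= v n) ->
  \sum_(0 <= i <oo) (if odd i then v i./2 else u i./2) <=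
  \sum_(0 <= i <oo) u i + \sum_(0 <= i <oo) v i.
Proof.
move=> u0 v0; pose w i := if odd i then v i./2 else u i./2.
have w0 i : 0 <= w i by rewrite /w; case: ifP.
have wE n : \sum_(0 <= i < n.*2) w i =
    \sum_(0 <= i < n) u i + \sum_(0 <= i < n) v i.
  elim: n => [|n IH]; first by rewrite !big_geq// adde0.
  rewrite doubleS !big_nat_recr//= IH /w /= odd_double /= uphalf_double doubleK.
  by rewrite -addeA addeACA.
apply: lime_le; first by apply: is_cvg_nneseries => i _ _; exact: w0.
near=> n; apply: (@le_trans _ _ (\sum_(0 <= i < n.*2) w i)).
  rewrite [leRHS](big_cat_nat _ (n := n))//=; last by rewrite -addnn leq_addr.
  by rewrite leeDl// sume_ge0.
by rewrite wE leeD//; apply: nneseries_lim_ge => i _ _.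
Unshelve. all: by end_near. Qed.

Lemma premeasureU s d A B : hausdorff_premeasure s d (A `|` B) <=
  hausdorff_premeasure s d A + hausdorff_premeasure s d B.
Proof.
have [->|fA] := eqVneq (hausdorff_premeasure s d A) +oo.
  by rewrite addye ?leey// gt_eqF// (lt_le_trans _ (premeasure_ge0 s d B)) ?ltNy0.
have [->|fB] := eqVneq (hausdorff_premeasure s d B) +oo.
  by rewrite addey ?leey// gt_eqF// (lt_le_trans _ (premeasure_ge0 s d A)) ?ltNy0.
have finA : hausdorff_premeasure s d A \is a fin_num.
  by rewrite ge0_fin_numE ?premeasure_ge0// ltey.
have finB : hausdorff_premeasure s d B \is a fin_num.
  by rewrite ge0_fin_numE ?premeasure_ge0// ltey.
apply/lee_addgt0Pr => e e0.
have e20 : (0 < e / 2)%R by rewrite divr_gt0.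
have [_ [U [AU Ud] <-] Ue] := lb_ereal_inf_adherent e20 finA.
have [_ [V [BV Vd] <-] Ve] := lb_ereal_inf_adherent e20 finB.
apply: (@le_trans _ _ (\sum_(0 <= i <oo) diam_pow s (U i) +
                       \sum_(0 <= i <oo) diam_pow s (V i))); last first.
  apply: le_trans (leeD (ltW Ue) (ltW Ve)) _.
  by rewrite addeACA -EFinD -splitr.
apply: le_trans (nneseries_interleave _ _); last 2 first.
- by move=> n; exact: diam_pow_ge0.
- by move=> n; exact: diam_pow_ge0.
pose W i := if odd i then V i./2 else U i./2.
have := @premeasure_le_cover s d (A `|` B) W.
rewrite (eq_eseriesr (g := fun i => if odd i then diam_pow s (V i./2)
  else diam_pow s (U i./2))); last by move=> i _; rewrite /W; case: ifP.
apply; last by rewrite /W => i; case: ifP.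
move=> x [/AU[i _ Ui]|/BV[i _ Vi]].
- by exists i.*2 => //; rewrite /W odd_double doubleK.
- by exists i.*2.+1 => //; rewrite /W /= odd_double /= uphalf_double.
Qed.

Lemma hausdorffU s A B :
  hausdorff_measure s (A `|` B) <= hausdorff_measure s A + hausdorff_measure s B.
Proof.
apply: ge_ereal_sup => _ [d d0 <-].
apply: le_trans (premeasureU _ _ _ _) _.
by apply: leeD; exact: premeasure_le_hausdorff.
Qed.

(** [Phi] is abstract because the bound serves both the premeasure at a fixed mesh and the measure
    itself. *)
Lemma subadditive_fin_cover (Phi : set R[i] -> \bar R) (I : finType)
    (P : pred I) A (B : I -> set R[i]) :
  Phi set0 = 0 -> (forall A, 0 <= Phi A) ->
  (forall A B, A `<=` B -> Phi A <= Phi B) ->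
  (forall A B, Phi (A `|` B) <= Phi A + Phi B) ->
  (forall x, A x -> exists2 i, P i & B i x) ->
  Phi A <= \sum_(i | P i) Phi (B i).
Proof.
move=> Phi0 Phi_ge0 mono sub AB.
(* The set has to vary with the list: once [B i] is split off, only the rest of [C] is covered by
   the tail. *)
suff : forall (e : seq I) C, (forall x, C x -> exists2 i, P i && (i \in e) & B i x) ->
    Phi C <= \sum_(i <- e | P i) Phi (B i).
  apply => x /AB[i Pi Bi]; exists i => //.
  by rewrite Pi mem_index_enum.
elim=> [|i e IH] C hC.
  rewrite big_nil (_ : C = set0) ?Phi0//.
  by apply/seteqP; split => // x /hC[j]; rewrite andbF.
rewrite big_cons; case: ifPn => Pi.
- apply: (@le_trans _ _ (Phi (B i `|` (C `\` B i)))).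
    by apply: mono => x Cx; have [?|?] := pselect (B i x); [left|right].
  apply: le_trans (sub _ _) _; rewrite leeD2l// IH// => x [/hC[j]].
  rewrite inE => /andP[Pj /orP[/eqP->|je]] Bj nB //.
  by exists j => //; rewrite Pj.
- apply: IH => x /hC[j /andP[Pj]]; rewrite inE => /orP[/eqP ji|je] Bj.
    by rewrite -ji Pj in Pi.
  by exists j => //; rewrite Pj.
Qed.

Lemma hausdorff_fin_cover s (I : finType) (P : pred I) A (B : I -> set R[i]) :
  (forall x, A x -> exists2 i, P i & B i x) ->
  hausdorff_measure s A <= \sum_(i | P i) hausdorff_measure s (B i).
Proof.
apply: subadditive_fin_cover;
  [exact: hausdorff_set0|exact: hausdorff_ge0|exact: hausdorff_mono|exact: hausdorffU].
Qed.

Lemma premeasure_fin_cover s d (I : finType) (P : pred I) A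
    (B : I -> set R[i]) :
  (forall x, A x -> exists2 i, P i & B i x) ->
  hausdorff_premeasure s d A <= \sum_(i | P i) hausdorff_premeasure s d (B i).
Proof.
apply: subadditive_fin_cover;
  [exact: premeasure_set0|exact: premeasure_ge0|exact: premeasure_mono|exact: premeasureU].
Qed.

Lemma premeasure_image (f : R[i] -> R[i]) s d r A : (0 <= s)%R -> (0 < r)%R ->
  (forall x y, (modulus (f x - f y) <= r * modulus (x - y))%R) ->
  hausdorff_premeasure s (r * d)%R (f @` A) <=
  (r `^ s)%:E * hausdorff_premeasure s d A.
Proof.
move=> s0 r0 fr; have rs0 : (0 < r `^ s)%R by exact: powR_gt0.
rewrite -lee_pdivrMl//; apply: le_ereal_inf_tmp => _ [U [AU Ud] <-].
rewrite lee_pdivrMl// -nneseriesZl; last by move=> *; exact: diam_pow_ge0.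
apply: (@le_trans _ _ (\sum_(0 <= i <oo) diam_pow s (f @` U i))).
  apply: premeasure_le_cover.
    by move=> _ [x /AU[i _ Ui] <-]; exists i => //; exists x.
  move=> i; apply: le_trans (diam_image _ r0 fr) _.
  by rewrite EFinM lee_pmul2l ?lte_fin.
apply: lee_nneseries => n *; first exact: diam_pow_ge0.
exact: diam_pow_image.
Qed.

Lemma hausdorff_image (f : R[i] -> R[i]) s r A : (0 <= s)%R -> (0 < r)%R ->
  (forall x y, (modulus (f x - f y) <= r * modulus (x - y))%R) ->
  hausdorff_measure s (f @` A) <= (r `^ s)%:E * hausdorff_measure s A.
Proof.
move=> s0 r0 fr; have rs0 : (0 < r `^ s)%R by exact: powR_gt0.
apply: ge_ereal_sup => _ [d d0 <-].
rewrite (_ : d = r * (d / r))%R; last by rewrite mulrCA divff ?mulr1// gt_eqF.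
apply: le_trans (premeasure_image _ _ s0 r0 fr) _.
rewrite lee_pmul2l ?lte_fin//; apply: premeasure_le_hausdorff.
by rewrite divr_gt0.
Qed.

Lemma diam_pow_le_dim s t d U : (0 <= s)%R -> (s < t)%R -> (0 < d)%R ->
  diam U <= d%:E -> diam_pow t U <= (d `^ (t - s))%:E * diam_pow s U.
Proof.
move=> s0 st d0 Ud; have [->|/set0P[x Ux]] := eqVneq U set0.
  by rewrite !diam_pow_set0 mule0.
rewrite !(diam_powE _ Ux).
have := diam_ge0 Ux; case: (diam U) Ud => [a| |]//; rewrite !lee_fin => ad a0.
have [->|an0] := eqVneq a 0%R.
  by rewrite powR0 ?gt_eqF ?(le_lt_trans s0)// mulr_ge0 ?powR_ge0.
have -> : (a `^ t = a `^ (t - s) * a `^ s)%R.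
  by rewrite -powRD ?subrK// an0 implybT.
rewrite ler_wpM2r ?powR_ge0// ge0_ler_powR ?nnegrE ?subr_ge0 ?(ltW st)//.
exact: ltW.
Qed.

Lemma hausdorff_eq0_dim s t A : (0 <= s)%R -> (s < t)%R ->
  hausdorff_measure s A < +oo -> hausdorff_measure t A = 0.
Proof.
move=> s0 st fin; apply/eqP; rewrite eq_le hausdorff_ge0 andbT.
apply: ge_ereal_sup => _ [d d0 <-].
have finH : hausdorff_measure s A \is a fin_num.
  by rewrite ge0_fin_numE ?hausdorff_ge0.
pose M := fine (hausdorff_measure s A).
have M0 : (0 <= M)%R by rewrite fine_ge0// hausdorff_ge0.
have M10 : (0 < M + 1)%R by rewrite ltr_wpDl.
apply/lee_addgt0Pr => e e0; rewrite add0e.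
have ts0 : (0 < t - s)%R by rewrite subr_gt0.
(* At this mesh the factor gained by raising the exponent is [e / (M + 1)]; [M + 1] avoids dividing
   by a vanishing mass. *)
pose d1 := ((e / (M + 1)) `^ (t - s)^-1)%R.
have d10 : (0 < d1)%R by rewrite powR_gt0 ?divr_gt0.
pose d' := Num.min d d1.
have d'0 : (0 < d')%R by rewrite lt_min d0 d10.
apply: (@le_trans _ _ (hausdorff_premeasure t d' A)).
  by apply: premeasure_anti; rewrite ge_min lexx.
apply: (@le_trans _ _ ((d' `^ (t - s))%:E * hausdorff_premeasure s d' A)).
  rewrite -lee_pdivrMl ?powR_gt0//; apply: le_ereal_inf_tmp => _ [U [AU Ud] <-].
  rewrite lee_pdivrMl ?powR_gt0// -nneseriesZl; last by move=> *; exact: diam_pow_ge0.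
  apply: (le_trans (premeasure_le_cover _ AU Ud)).
  apply: lee_nneseries => n *; first exact: diam_pow_ge0.
  exact: diam_pow_le_dim.
apply: (@le_trans _ _ ((d' `^ (t - s))%:E * hausdorff_measure s A)).
  by rewrite lee_pmul2l ?lte_fin ?powR_gt0//; exact: premeasure_le_hausdorff.
rewrite -(fineK finH) -EFinM lee_fin -/M.
apply: (@le_trans _ _ ((d1 `^ (t - s)) * M)%R).
  rewrite ler_wpM2r// ge0_ler_powR ?nnegrE ?(ltW ts0) ?(ltW d'0) ?(ltW d10)//.
  by rewrite ge_min lexx orbT.
rewrite -powRrM mulVf ?gt_eqF// powRr1 ?divr_ge0 ?(ltW e0) ?(ltW M10)//.
rewrite -mulrA ler_piMr ?(ltW e0)// mulrC ler_pdivrMr// mul1r.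
by rewrite lerDl.
Qed.

End HausdorffTheory.

(** * Moran's equation and packing *)

Section MoranExponent.
Variable R : realType.

Lemma expr_small (r e : R) : 0 <= r < 1 -> 0 < e ->
  exists N, forall n, (N <= n)%N -> r ^+ n < e.
Proof.
move=> /andP[r0 r1] e0.
have /cvgrPdist_lt/(_ _ e0)[N _ HN] : (r ^+ n @[n --> \oo] --> 0)%classic.
  by apply: cvg_expr; rewrite ger0_norm.
exists N => n Nn; have := HN n Nn.
by rewrite sub0r normrN ger0_norm ?exprn_ge0.
Qed.

(** The default [2^-1] of the maximum keeps [rho] inside the open interval even for an empty [I]. *)
Lemma fin_common_lt1 (I : finType) (r : I -> R) : (forall i, 0 < r i < 1) ->
  exists2 rho : R, 0 < rho < 1 & forall i, r i <= rho.
Proof.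
move=> r01; exists (\big[Num.max/2^-1]_i r i); last first.
  by move=> i; exact: le_bigmax.
apply/andP; split; first by apply: lt_le_trans (bigmax_ge_id _ _ _ _).
by apply: bigmax_lt => [|i _]; [lra|case/andP: (r01 i)].
Qed.

Lemma fin_common_gt0 (I : finType) (c : I -> R) : (forall i, 0 < c i) ->
  exists2 c0 : R, 0 < c0 <= 1 & forall i, c0 <= c i.
Proof.
move=> cpos; exists (\big[Num.min/1]_i c i); last by move=> i; exact: bigmin_le.
apply/andP; split; last exact: bigmin_le_id.
by apply: lt_bigmin => // i _.
Qed.

(** The sum is continuous in the exponent, equals [#|I|] at 0, and is at most 1 at any [N] for which
    [rho ^+ N] is below the inverse of [#|I|]. *)
Lemma moran_exponent_exists (I : finType) (r : I -> R) :
  (forall i, 0 < r i < 1) -> (1 < #|I|)%N ->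
  exists2 D : R, 0 < D & \sum_i r i `^ D = 1.
Proof.
move=> r01 I1.
have r0 i : 0 < r i by case/andP: (r01 i).
pose g (d : R) := \sum_i r i `^ d.
have [rho /andP[rho0 rho1] rrho] := fin_common_lt1 r01.
have g0 : 1 < g 0.
  rewrite /g (eq_bigr (fun=> 1)) => [|i _]; last by rewrite powRr0.
  by rewrite sumr_const -mulr_natr mul1r ltr1n.
have [N HN] : exists N, forall n, (N <= n)%N -> rho ^+ n < (#|I|%:R)^-1.
  apply: expr_small; first by rewrite (ltW rho0).
  by rewrite invr_gt0 ltr0n (leq_trans _ I1).
have gN : g N%:R <= 1.
  apply: (@le_trans _ _ (\sum_(i : I) (#|I|%:R)^-1)).
    apply: ler_sum => i _; apply: le_trans (ltW (HN N (leqnn _))).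
    rewrite powR_mulrn; last exact: ltW.
    by rewrite lerXn2r ?nnegrE ?(ltW (r0 i)) ?(ltW rho0).
  rewrite sumr_const -[X in X <= _]mulr_natr mulVf// pnatr_eq0 -lt0n.
  exact: leq_trans I1.
have cg : continuous g.
  have -> : g = (fun d => \sum_i expR (d * ln (r i))).
    by apply/funext => d; apply: eq_bigr => i _; rewrite /powR gt_eqF.
  elim: (index_enum I) => [|i e IH] x.
    under eq_fun do rewrite big_nil; exact: cvg_cst.
  under eq_fun do rewrite big_cons.
  apply: cvgD; last exact: IH.
  apply: continuous_cvg; first exact: continuous_expR.
  by apply: cvgM; [exact: cvg_id|exact: cvg_cst].
have [||c cN gc] := @IVT R g 0 N%:R 1 (ler0n _ _).
- by apply: continuous_subspaceT => x; exact: cg.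
- by rewrite ge_min le_max gN (ltW g0) orbT.
exists c; last exact: gc.
rewrite lt_def (itvP cN) andbT; apply/eqP => c0.
by move: g0; rewrite -c0 gc ltxx.
Qed.

End MoranExponent.

Section Packing.
Variable R : realType.

Lemma truncn_eq_dist (a b : R) : 0 <= a -> 0 <= b ->
  Num.truncn a = Num.truncn b -> `|a - b| < 1.
Proof.
move=> a0 b0 ab; have /andP[a1 a2] := truncn_itv a0.
have /andP[b1 b2] := truncn_itv b0.
move: a1 a2; rewrite ab => a1 a2; rewrite -natr1 in a2 b2.
by rewrite ltr_norml; apply/andP; split; lra.
Qed.

(* Distinct points fall into distinct cells of a square grid of mesh rho / 2. *)
Lemma packing_bound (T : eqType) (c : T -> R[i]) (c0 : R[i]) (rho rad : R)
    (s : seq T) :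
  0 < rho -> 0 <= rad ->
  pairwise (fun v w => rho <= modulus (c v - c w)) s ->
  (forall v, v \in s -> modulus (c v - c0) <= rad) ->
  (size s <= (Num.truncn (4 * rad / rho)).+1 ^ 2)%N.
Proof.
move=> rho0 rad0 sep inball.
pose K := Num.truncn (4 * rad / rho).
pose h (t : R) := 2 * (t + rad) / rho.
pose code v := (Num.truncn (h (complex.Re (c v - c0))),
                Num.truncn (h (complex.Im (c v - c0)))).
have h0 t : `|t| <= rad -> 0 <= h t.
  rewrite ler_norml => /andP[t0 _]; rewrite /h divr_ge0 ?(ltW rho0)//; lra.
have hK t : `|t| <= rad -> (Num.truncn (h t) < K.+1)%N.
  rewrite ler_norml ltnS => /andP[t1 t2]; apply: le_truncn.
  rewrite /h ler_pM2r ?invr_gt0//; lra.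
have hd t u : `|t| <= rad -> `|u| <= rad -> Num.truncn (h t) = Num.truncn (h u) ->
    `|t - u| < rho / 2.
  move=> tr ur /(truncn_eq_dist (h0 _ tr) (h0 _ ur)).
  rewrite /h -mulrBl -mulrBr opprD addrACA subrr addr0.
  rewrite 2!normrM normfV (gtr0_norm rho0) (ger0_norm (ler0n _ 2)).
  rewrite ltr_pdivrMr// mul1r; lra.
have Rev v : v \in s -> `|complex.Re (c v - c0)| <= rad.
  by move=> vs; exact: le_trans (normc_Re _) (inball _ vs).
have Imv v : v \in s -> `|complex.Im (c v - c0)| <= rad.
  by move=> vs; exact: le_trans (normc_Im _) (inball _ vs).
have ucode : uniq [seq code v | v <- s].
  rewrite uniq_pairwise pairwise_map.
  apply: (sub_in_pairwise (P := [in s])) sep; last by apply/allP.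
  move=> v w vs ws /=; apply: contraTneq => -[eR eI].
  rewrite -ltNge; apply: le_lt_trans (normc_le_ReIm _) _.
  have -> : c v - c w = (c v - c0) + (- (c w - c0)) by rewrite opprB addrA subrK.
  rewrite ReD ImD.
  have -> : complex.Re (- (c w - c0)) = - complex.Re (c w - c0) by case: (c w - c0).
  have -> : complex.Im (- (c w - c0)) = - complex.Im (c w - c0) by case: (c w - c0).
  have := hd _ _ (Rev _ vs) (Rev _ ws) eR.
  have := hd _ _ (Imv _ vs) (Imv _ ws) eI.
  lra.
rewrite -(size_map code) -[(_ ^ 2)%N](_ : size
    [seq (a, b) | a <- iota 0 K.+1, b <- iota 0 K.+1] = _); last first.
  by rewrite size_allpairs !size_iota mulnn.
apply: uniq_leq_size => // _ /mapP[v vs ->].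
apply/allpairsP; exists (code v); split => //; rewrite mem_iota /= add0n.
- exact/hK/Rev.
- exact/hK/Imv.
Qed.

End Packing.

(** * Self-similar sets under the open set condition *)

Section IteratedFunctionSystem.
Variables (R : realType) (I : finType) (f : I -> R[i] -> R[i]) (r : I -> R).
Variables (Lam : set R[i]) (D : R).
Hypothesis f_sim :
  forall i x y, modulus (f i x - f i y) = r i * modulus (x - y).
Hypothesis f_surj : forall i y, exists x, f i x = y.
Hypothesis r01 : forall i, 0 < r i < 1.
Hypothesis Lam_stable : forall i x, Lam x -> Lam (f i x).
Hypothesis Lam_cover : forall x, Lam x -> exists i, (f i @` Lam) x.
Hypothesis Lam_compact : compact Lam.
Hypothesis D_gt0 : 0 < D.
Hypothesis moran : \sum_i r i `^ D = 1.

Let r_gt0 i : 0 < r i. Proof. by case/andP: (r01 i). Qed.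

Lemma f_lip i x y : modulus (f i x - f i y) <= r i * modulus (x - y).
Proof. by rewrite f_sim. Qed.

Lemma moran_sum_ereal (m : \bar R) : (\sum_i (r i `^ D)%:E * m)%E = m.
Proof.
rewrite -ge0_sume_distrl; last by move=> i _; rewrite lee_fin powR_ge0.
by rewrite sumEFin moran mul1e.
Qed.

(* Subdividing a cover once multiplies the mesh by at most rho and, by Moran's
   equation, does not increase the sum of the D-th powers. *)
Lemma premeasure_attractor (rho d : R) (n : nat) :
  (forall i, r i <= rho) -> 0 < d ->
  (hausdorff_premeasure D (rho ^+ n * d) Lam <= hausdorff_premeasure D d Lam)%E.
Proof.
move=> rrho d0; elim: n => [|n IH]; first by rewrite mul1r.
apply: le_trans IH; rewrite exprS -mulrA; set e := rho ^+ n * d.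
have [/eqP Lam0|/set0P[x Lx]] := boolP (Lam == set0).
  by rewrite Lam0 !premeasure_set0.
have [i0 _] := Lam_cover Lx.
have e0 : 0 <= e.
  by rewrite mulr_ge0 ?(ltW d0)// exprn_ge0// (le_trans (ltW (r_gt0 i0))).
have cov y : Lam y -> exists2 i, predT i & (f i @` Lam) y.
  by case/Lam_cover => i; exists i.
apply: le_trans (premeasure_fin_cover _ _ cov) _.
rewrite -[leRHS]moran_sum_ereal; apply: lee_sum => i _.
apply: le_trans (premeasure_image e Lam (ltW D_gt0) (r_gt0 i) (f_lip i)).
by apply: premeasure_anti; rewrite ler_wpM2r.
Qed.

(** At mesh [d] the set [Lam] covers itself at finite cost, and refining this cover down to any mesh
    does not raise the cost. *)
Lemma hausdorff_attractor_lty : (hausdorff_measure D Lam < +oo)%E.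
Proof.
have [B B0 LB] := compact_normc_bounded Lam_compact.
have [rho /andP[rho0 rho1] rrho] := fin_common_lt1 r01.
pose d := B + B; have d0 : 0 < d by rewrite addr_gt0.
have Ld : (diam Lam <= d%:E)%E.
  apply: diam_le => x y Lx Ly; apply: le_trans (normcD _ _) _.
  by rewrite normcN lerD// LB.
apply: (@le_lt_trans _ _ (diam_pow D Lam)); last first.
  rewrite /diam_pow; case: ifP => // _; apply: poweR_lty.
  exact: le_lt_trans Ld (ltry _).
apply: ge_ereal_sup => _ [e /= e0 <-].
have [N HN] : exists N, forall n, (N <= n)%N -> rho ^+ n < e / d.
  by apply: expr_small; [rewrite (ltW rho0)|rewrite divr_gt0].
apply: le_trans (premeasure_diam _ Ld).
apply: le_trans (premeasure_attractor N rrho d0).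
apply: premeasure_anti; rewrite -ler_pdivlMr//.
exact/ltW/HN.
Qed.

(** The first letter is the outermost map, so appending a letter with [rcons] passes to a
    subcylinder. *)
Fixpoint word_map (w : seq I) (x : R[i]) : R[i] :=
  if w is i :: w' then f i (word_map w' x) else x.

Definition word_ratio (w : seq I) : R := \prod_(i <- w) r i.

Lemma word_map_rcons w i x : word_map (rcons w i) x = word_map w (f i x).
Proof. by elim: w => //= j w ->. Qed.

Lemma word_ratio_rcons w i : word_ratio (rcons w i) = word_ratio w * r i.
Proof. by rewrite /word_ratio big_rcons/= mulrC. Qed.

Lemma word_ratio_gt0 w : 0 < word_ratio w.
Proof. by rewrite /word_ratio; apply: prodr_gt0. Qed.

Lemma word_map_sim w x y :
  modulus (word_map w x - word_map w y) = word_ratio w * modulus (x - y).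
Proof.
rewrite /word_ratio; elim: w => [|i w IH] /=; first by rewrite big_nil mul1r.
by rewrite big_cons f_sim IH mulrA.
Qed.

Lemma word_map_inj w x y : word_map w x = word_map w y -> x = y.
Proof.
move=> wxy; apply/eqP; rewrite -subr_eq0 -normc_eq0.
have := word_map_sim w x y; rewrite wxy subrr normc0 => /esym/eqP.
by rewrite mulf_eq0 gt_eqF//= word_ratio_gt0.
Qed.

Lemma word_map_surj w y : exists x, word_map w x = y.
Proof.
elim: w y => [|i w IH] y /=; first by exists y.
by have [x <-] := f_surj i y; have [x' <-] := IH x; exists x'.
Qed.

Lemma word_map_stable w x : Lam x -> Lam (word_map w x).
Proof. by move=> Lx; elim: w => //= i w; exact: Lam_stable. Qed.

(** * Lower bound for the Hausdorff measure under the open set condition *)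

Variables (x0 : R[i]) (O : set R[i]) (c0 : R[i]) (rho0 : R).
Hypothesis Lam_x0 : Lam x0.
Hypothesis O_stable : forall i x, O x -> O (f i x).
Hypothesis O_disjoint : forall i j, i != j -> (f i @` O) `&` (f j @` O) = set0.
Hypothesis rho0_gt0 : 0 < rho0.
Hypothesis O_ball : forall x, modulus (c0 - x) < rho0 -> O x.

(* The mass that the level-n refinement of the cylinder w gives to U, relative
   to the mass of the cylinder. *)
Fixpoint mass (U : set R[i]) (n : nat) (w : seq I) : R :=
  if n is n'.+1 then \sum_i r i `^ D * mass U n' (rcons w i)
  else (`[< U (word_map w x0) >])%:R.

Definition meets (U : set R[i]) (w : seq I) : bool :=
  `[< exists2 x, Lam x & U (word_map w x) >].

(* The subdivision of the cylinder w into cylinders of ratio at most d, with at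
   most n subdivision steps. *)
Fixpoint cut (d : R) (n : nat) (w : seq I) : seq (seq I) :=
  if n is n'.+1 then
    if word_ratio w <= d then [:: w]
    else flatten [seq cut d n' (rcons w i) | i <- enum I]
  else [:: w].

Lemma mass_le1 U n w : mass U n w <= 1.
Proof.
elim: n w => [|n IH] w /=; first by case: asbool.
rewrite -[leRHS]moran; apply: ler_sum => i _.
by rewrite ler_piMr ?powR_ge0.
Qed.

Lemma mass_notmeets U n w : ~~ meets U w -> mass U n w = 0.
Proof.
elim: n w => [|n IH] w /asboolP wU /=.
  by case: asboolP => // Uw; case: wU; exists x0.
rewrite big1// => i _; rewrite IH ?mulr0//.
apply/asboolP => -[x Lx]; rewrite word_map_rcons => Ux.
by apply: wU; exists (f i x) => //; exact: Lam_stable.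
Qed.

(** Only cylinders of the cut that meet [U] contribute to its mass, and each contributes at most its
    full weight. *)
Lemma mass_le_cut U d n w :
  word_ratio w `^ D * mass U n w <=
  \sum_(v <- cut d n w | meets U v) word_ratio v `^ D.
Proof.
have base m u : word_ratio u `^ D * mass U m u <=
    \sum_(v <- [:: u] | meets U v) word_ratio v `^ D.
  rewrite big_cons big_nil; case: ifPn => [_|/(mass_notmeets m) ->].
    by rewrite addr0 ler_piMr ?powR_ge0// mass_le1.
  by rewrite mulr0.
elim: n w => [|n IH] w; first exact: base.
have [wd|wd] := boolP (word_ratio w <= d).
  by rewrite /cut wd; exact: base.
rewrite /= (negbTE wd) big_flatten big_map big_enum mulr_sumr.
apply: ler_sum => i _; apply: le_trans (IH _).
by rewrite word_ratio_rcons powRM ?(ltW (word_ratio_gt0 _)) ?(ltW (r_gt0 _))// mulrA.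
Qed.

(** The second hypothesis says that [n] subdivisions are enough, as each multiplies the ratio by at
    most [rho]. *)
Lemma cut_ratio_le rho d n w v : (forall i, r i <= rho) ->
  rho ^+ n * word_ratio w <= d -> v \in cut d n w -> word_ratio v <= d.
Proof.
move=> rrho; elim: n w => [|n IH] w /=.
  by rewrite mul1r => wd; rewrite inE => /eqP->.
case: ifPn => [wd _|_ wd]; first by rewrite inE => /eqP->.
move=> /flatten_mapP[i _]; apply: IH; apply: le_trans wd.
rewrite word_ratio_rcons exprSr -mulrA ler_wpM2l//.
  by rewrite exprn_ge0// (le_trans (ltW (r_gt0 i))).
by rewrite mulrC ler_wpM2r// ltW// word_ratio_gt0.
Qed.

(** A cylinder is subdivided only while its ratio exceeds [d], and one subdivision costs at most a
    factor [rmin]. *)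
Lemma cut_ratio_ge rmin d n w v : (forall i, rmin <= r i) -> 0 <= d ->
  rmin * d <= word_ratio w -> v \in cut d n w -> rmin * d <= word_ratio v.
Proof.
move=> rrmin d0; elim: n w => [|n IH] w wd /=; first by rewrite inE => /eqP->.
case: ifPn => [_|]; first by rewrite inE => /eqP->.
rewrite -ltNge => dw /flatten_mapP[i _]; apply: IH.
rewrite word_ratio_rcons mulrC; apply: (@le_trans _ _ (d * r i)).
  by rewrite ler_wpM2l.
by rewrite ler_wpM2r ?ltW.
Qed.

Definition word_disjoint : rel (seq I) := fun v w =>
  `[< (word_map v @` O) `&` (word_map w @` O) = set0 >].

Lemma cut_sub d n w v : v \in cut d n w -> word_map v @` O `<=` word_map w @` O.
Proof.
elim: n w => [|n IH] w /=; first by rewrite inE => /eqP->.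
case: ifPn => _; first by rewrite inE => /eqP->.
move=> /flatten_mapP[i _] /IH vO _ /vO[x Ox <-].
by exists (f i x); [exact: O_stable|rewrite word_map_rcons].
Qed.

Lemma rcons_disjoint w i j : i != j ->
  (word_map (rcons w i) @` O) `&` (word_map (rcons w j) @` O) = set0.
Proof.
move=> ij; apply/seteqP; split => // _ [[x Ox <-] [y Oy]].
rewrite !word_map_rcons => /word_map_inj yx.
have : ((f i @` O) `&` (f j @` O)) (f i x) by split; [exists x|exists y].
by rewrite O_disjoint.
Qed.

(** Subcylinders for different letters have disjoint images of [O], and [cut_sub] hands this down to
    everything cut out of them. *)
Lemma cut_disjoint d n w : pairwise word_disjoint (cut d n w).
Proof.
elim: n w => [//|n IH] w /=; case: ifPn => // _.
have : uniq (enum I) by exact: enum_uniq.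
elim: (enum I) => //= i e IHe /andP[ie ue].
rewrite pairwise_cat IH IHe// !andbT; apply/allrelP => u v ui /flatten_mapP[j je vj].
apply/asboolP/seteqP; split => // x [/(cut_sub ui) xi /(cut_sub vj) xj].
rewrite -(rcons_disjoint w (i := i) (j := j)); first by split.
by apply: contraNneq ie => ->.
Qed.

(** In the cut at scale [d], the cylinders meeting [U] have ratios between [rmin * d] and [d]. Their
    images of [c0] are separated by [rho0 * rmin * d] and stay within [Delta * d] of one point, so
    packing bounds their number independently of [d]. *)
Lemma mass_bound : exists2 N : R, 0 < N & forall (d : R) (U : set R[i]), 0 < d ->
  (forall x y, U x -> U y -> modulus (x - y) <= d) ->
  exists n0, forall n, (n0 <= n)%N -> mass U n [::] <= N * d `^ D.
Proof.
have [B B0 LB] := compact_normc_bounded Lam_compact.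
have [rho /andP[rho_gt0 rho1] rrho] := fin_common_lt1 r01.
have [rmin /andP[rmin0 rmin1] rrmin] := fin_common_gt0 r_gt0.
(* [modulus c0 + B] bounds the distance from [c0] to [Lam] points before scaling; the summand 1
   accounts for the diameter of [U]. *)
pose Delta := modulus c0 + B + 1.
have Delta0 : 0 <= Delta by rewrite !addr_ge0 ?normc_ge0 ?(ltW B0).
pose K := ((Num.truncn (4 * Delta / (rho0 * rmin))).+1 ^ 2)%N.
exists K%:R; first by rewrite ltr0n expn_gt0.
have K1 : 1 <= K%:R :> R by rewrite ler1n expn_gt0.
move=> d U d0 Ud.
(* The lower bound on the ratios of the cut starts from the empty word, of ratio 1, and so asks for
   [rmin * d <= 1]. For [d >= 1] the total mass 1 is a sufficient bound. *)
have [d1|d1] := leP 1 d.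
  exists 0%N => n _; apply: le_trans (mass_le1 _ _ _) _.
  apply: mulr_ege1 => //; rewrite -(powRr0 d) ler_powR//; exact: ltW.
have [n0 Hn0] : exists N, forall n, (N <= n)%N -> rho ^+ n < d.
  by apply: expr_small; rewrite ?(ltW rho_gt0).
exists n0 => n /Hn0 nd.
have w1 : word_ratio [::] = 1 by rewrite /word_ratio big_nil.
have -> : mass U n [::] = word_ratio [::] `^ D * mass U n [::].
  by rewrite w1 powR1 mul1r.
apply: le_trans (mass_le_cut U d n [::]) _.
pose s := [seq v <- cut d n [::] | meets U v].
have sle v : v \in s -> word_ratio v <= d.
  rewrite mem_filter => /andP[_]; apply: (cut_ratio_le rrho).
  by rewrite w1 mulr1 ltW// nd// rho_gt0.
have sge v : v \in s -> rmin * d <= word_ratio v.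
  rewrite mem_filter => /andP[_]; apply: cut_ratio_ge => //; first exact: ltW.
  by rewrite w1 mulr_ile1// ltW.
have ssize : (size s <= K)%N.
  have [s0|] := leqP (size s) 0; first exact: leq_trans s0 _.
  rewrite lt0n size_eq0 => /eqP sn0.
  have [v0 v0s] : exists v0, v0 \in s.
    by case: {sle sge} s sn0 => // v0 s' _; exists v0; rewrite mem_head.
  have /asboolP[y0 _ Uy0] : meets U v0.
    by move: v0s; rewrite mem_filter => /andP[].
  rewrite /K.
  have -> : 4 * Delta / (rho0 * rmin) = 4 * (Delta * d) / (rho0 * rmin * d).
    by field; rewrite !gt_eqF.
  apply: (packing_bound (c := fun v => word_map v c0)
    (c0 := word_map v0 y0)).
  - by rewrite !mulr_gt0.
  - by rewrite mulr_ge0// ltW.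
  - apply: (sub_in_pairwise (P := [in s])); last 2 first.
    + by apply/allP.
    + by apply: pairwise_filter; exact: cut_disjoint d n [::].
    (* If the centres were closer, [word_map w c0] would lie in the image under [word_map v] of the
       ball around [c0], hence in both images of [O]. *)
    move=> v w vs ws /asboolP vw; rewrite leNgt; apply/negP => lt_vw.
    have rwv : rho0 * rmin * d <= word_ratio v * rho0.
      by rewrite [leRHS]mulrC -mulrA ler_wpM2l ?sge// ltW.
    have : ((word_map v @` O) `&` (word_map w @` O)) (word_map w c0).
      split; last by exists c0 => //; apply: O_ball; rewrite subrr normc0.
      have [x xw] := word_map_surj v (word_map w c0); exists x => //.
      apply: O_ball; rewrite -(ltr_pM2l (word_ratio_gt0 v)) -word_map_sim xw.
      exact: lt_le_trans lt_vw _.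
    by rewrite vw.
  - move=> v vs.
    have /asboolP[y Ly Uy] : meets U v by move: vs; rewrite mem_filter => /andP[].
    apply: le_trans (normc_distD (word_map v y) _ _) _.
    rewrite word_map_sim.
    have := Ud _ _ Uy Uy0.
    have : word_ratio v * modulus (c0 - y) <= d * (modulus c0 + B).
      apply: ler_pM; rewrite ?normc_ge0 ?sle ?(ltW (word_ratio_gt0 _))//.
      by apply: le_trans (normcD _ _) _; rewrite normcN lerD2l LB.
    rewrite /Delta; lra.
rewrite -big_filter; apply: (@le_trans _ _ (\sum_(v <- s) d `^ D)).
  rewrite big_seq [leRHS]big_seq; apply: ler_sum => v vs.
  by rewrite ge0_ler_powR ?nnegrE ?sle ?(ltW D_gt0) ?(ltW d0) ?(ltW (word_ratio_gt0 _)).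
rewrite big_const_seq count_predT iter_addr_0 -[leLHS]mulr_natl.
by rewrite ler_wpM2r ?powR_ge0// ler_nat.
Qed.

(** Open enlargements at a small extra cost make compactness applicable to an arbitrary cover. *)
Lemma fatten (U : set R[i]) (d e : R) : (diam U <= d%:E)%E -> 0 < e ->
  exists V : set R[i], [/\ open V, U `<=` V & exists d' : R,
    [/\ 0 < d', forall x y, V x -> V y -> modulus (x - y) <= d' &
      ((d' `^ D)%:E <= diam_pow D U + e%:E)%E]].
Proof.
move=> Ud e0.
have [a [a0 Ua aU]] : exists a : R, [/\ 0 <= a,
    forall x y, U x -> U y -> modulus (x - y) <= a &
    ((a `^ D)%:E <= diam_pow D U)%E].
  have [->|/set0P[x Ux]] := eqVneq U set0.
    exists 0; split => //.
    by rewrite powR0 ?gt_eqF// diam_pow_set0.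
  have := diam_ge0 Ux; have := diam_powE D Ux; have := @le_diam _ U.
  case: (diam U) Ud => [a| |]; last 2 first.
  - by rewrite leye_eq.
  - by move=> _ _ _; rewrite leNgt ltNy0.
  move=> _ Ua -> a0; exists a; split => //.
(* [d'] is the diameter whose [D]-th power spends the allowance [e] exactly; half of [d' - a] is
   left for thickening on each side. *)
pose d' := (a `^ D + e) `^ D^-1.
have ae0 : 0 < a `^ D + e by rewrite ltr_wpDl ?powR_ge0.
have d'D : d' `^ D = a `^ D + e by rewrite -powRrM mulVf ?powRr1 ?gt_eqF ?ltW.
have ad' : a < d'.
  rewrite ltNge; apply/negP => d'a.
  have : d' `^ D <= a `^ D.
    by rewrite ge0_ler_powR ?nnegrE ?powR_ge0 ?(ltW D_gt0).
  by rewrite d'D gerDl leNgt e0.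
have eta0 : 0 < (d' - a) / 2 by rewrite divr_gt0// subr_gt0.
exists (\bigcup_(u in U) [set v | modulus (u - v) < (d' - a) / 2]); split.
- by apply: bigcup_open => u _; exact: open_normc_ball.
- by move=> u Uu; exists u => //=; rewrite subrr normc0.
exists d'; split; first by rewrite powR_gt0.
- move=> x y [u Uu /= ux] [v Uv /= vy].
  apply: le_trans (normc_distD u _ _) _; rewrite normc_distC.
  have := normc_distD v u y; have := Ua _ _ Uu Uv; lra.
- by rewrite d'D EFinD leeD2r.
Qed.

(** At depth 0 the marked point [word_map w x0] lies in some [V j]; Moran's equation carries the
    bound to every depth. *)
Lemma mass_cover (J : {fset nat}) (V : nat -> set R[i]) n w :
  Lam `<=` \bigcup_(j in [set` J]) V j ->
  1 <= \sum_(j <- J) mass (V j) n w.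
Proof.
move=> LV; elim: n w => [|n IH] w /=.
  have [j /= jJ Vj] := LV _ (word_map_stable w Lam_x0).
  by rewrite (big_fsetD1 j)//= (asboolT Vj) lerDl sumr_ge0.
rewrite exchange_big/= -moran; apply: ler_sum => i _.
by rewrite -mulr_sumr ler_peMr ?powR_ge0.
Qed.

(** This is the mass distribution principle: the sets of a cover together carry mass at least 1,
    while each carries at most [N] times the [D]-th power of its diameter. *)
Lemma hausdorff_attractor_gt0 : (0 < hausdorff_measure D Lam)%E.
Proof.
have [N N0 HN] := mass_bound.
(* Covers by open sets would give [N^-1]; half of it pays for the enlargement. *)
suff : ((N^-1 / 2)%:E <= hausdorff_premeasure D 1 Lam)%E.
  move=> le1; apply: (@lt_le_trans _ _ (N^-1 / 2)%:E).
    by rewrite lte_fin divr_gt0 ?invr_gt0.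
  exact: le_trans le1 (premeasure_le_hausdorff _ _ ltr01).
apply: le_ereal_inf_tmp => _ [U [LU Ud] <-].
pose e : R := N^-1 / 2; have e0 : 0 < e by rewrite divr_gt0 ?invr_gt0.
have en0 n : 0 < e / (2 ^ n.+1)%:R by rewrite divr_gt0// ltr0n expn_gt0.
have [V HV] := choice (fun n => fatten (Ud n) (en0 n)).
have Vop n : open (V n) by case: (HV n).
have UV n : U n `<=` V n by case: (HV n).
have {HV} Vd n : exists d' : R, [/\ 0 < d',
    forall x y, V n x -> V n y -> modulus (x - y) <= d' &
    ((d' `^ D)%:E <= diam_pow D (U n) + (e / (2 ^ n.+1)%:R)%:E)%E].
  by case: (HV n).
have [d {Vd}Hd] := choice Vd.
have Hd0 n : 0 < d n by case: (Hd n).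
have Vd n : forall x y, V n x -> V n y -> modulus (x - y) <= d n by case: (Hd n).
have [n0 Hn0] := choice (fun n => HN (d n) (V n) (Hd0 n) (Vd n)).
have := Lam_compact; rewrite compact_cover => /(_ nat setT V)[||J _ LJ].
- by move=> j _; exact: Vop.
- by move=> x /LU[j _ Uj]; exists j => //; exact: UV.
(* The depth required by [mass_bound] depends on the set; a finite subcover admits a common one. *)
pose m := \max_(j <- J) n0 j.
have : 1 <= N * \sum_(j <- J) d j `^ D.
  apply: le_trans (mass_cover m [::] LJ) _; rewrite mulr_sumr.
  rewrite big_seq [leRHS]big_seq; apply: ler_sum => j jJ.
  by apply: Hn0; exact: leq_bigmax_seq.
rewrite -ler_pdivrMl// mulr1 -lee_fin => NJ.
suff : (N^-1%:E <= \sum_(0 <= i <oo) diam_pow D (U i) + e%:E)%E.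
  by rewrite [X in (X%:E <= _)%E](splitr N^-1) EFinD -leeBrDr// addeK.
apply: le_trans NJ _; rewrite -sumEFin.
apply: le_trans (lee_sum_fset_lim J xpredT _) _.
  by move=> j _; rewrite lee_fin powR_ge0.
apply: le_trans (epsilon_trick xpredT _ (ltW e0)).
  apply: lee_nneseries => n *; first by rewrite lee_fin powR_ge0.
  by case: (Hd n).
by move=> n; exact: diam_pow_ge0.
Qed.

Lemma hausdorff_dim_attractor : hausdorff_dim Lam = D%:E.
Proof.
apply/eqP; rewrite eq_le; apply/andP; split.
- apply/lee_addgt0Pr => e e0; apply: ereal_inf_lbound; exists (D + e) => //.
  split; first by rewrite addr_ge0 ?ltW.
  apply: hausdorff_eq0_dim hausdorff_attractor_lty; first exact: ltW.
  by rewrite ltrDl.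
- apply: le_ereal_inf_tmp => _ [t [t0 Ht] <-]; rewrite lee_fin leNgt.
  apply/negP => tD; have := hausdorff_attractor_gt0.
  by rewrite (hausdorff_eq0_dim t0 tD) ?ltxx// Ht.
Qed.

End IteratedFunctionSystem.

(** * Arguments and triangles *)

Section Argument.
Variable R : realType.
Implicit Types (t : R) (w : R[i]).

(** Uniqueness of the angle is the half-angle formula: cos a = 1 - 2 sin(a/2)^2, and sin(a/2) > 0
    for 0 < a < 2 pi. *)
Lemma arg_pos t : 0 < t -> arg (t%:C : R[i]) = 0.
Proof.
move=> t0; rewrite /arg.
set P := (X in xget 0 X).
have P0 : P 0.
  split; first by rewrite lexx mulr_gt0 ?pi_gt0.
  by rewrite normc_real gtr0_norm// cos0 sin0; apply/eqP; rewrite eq_complex/=;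
    rewrite !mul0r !mulr0 mulr1 subr0 addr0 !eqxx.
have [] : P (xget 0 P) by apply: xgetPex; exists 0.
move: (xget 0 P) => a /andP[a0 a2pi].
rewrite normc_real gtr0_norm// => /eqP; rewrite eq_complex /= => /andP[/eqP H _].
have cosa : cos a = 1.
  by apply: (mulfI (lt0r_neq0 t0)); rewrite mulr1 {2}H mul0r subr0.
apply/eqP; rewrite eq_le a0 andbT leNgt; apply/negP => apos.
have : 0 < sin (a / 2) by apply: sin_gt0_pi; apply/andP; split; lra.
have : cos (a / 2 + a / 2) = 1 by rewrite -splitr.
rewrite cosD -!expr2 cos2sin2 => s0 /gt_eqF/negP; apply.
by rewrite -sqrf_eq0; apply/eqP; lra.
Qed.

Lemma polar_exists w : w != 0 -> exists t, 0 <= t < 2 * pi /\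
  w = (modulus w)%:C * (cos t +i* sin t).
Proof.
move=> w0; pose m := modulus w; have m0 : 0 < m by rewrite normc_gt0.
pose u := complex.Re w / m; pose v := complex.Im w / m.
have uv : u ^+ 2 + v ^+ 2 = 1.
  rewrite !expr_div_n -mulrDl.
  have -> : complex.Re w ^+ 2 + complex.Im w ^+ 2 = m ^+ 2.
    by rewrite /m; case: (w) => a b /=; rewrite sqr_sqrtr// addr_ge0 ?sqr_ge0.
  by rewrite divff// expf_neq0 ?gt_eqF.
have u1 : -1 <= u <= 1.
  have u21 : u ^+ 2 <= 1 by rewrite -uv lerDl sqr_ge0.
  by rewrite -ler_norml -(@expr_le1 _ 2)// real_normK ?num_real.
suff [t [tpi ct st]] : exists t, [/\ 0 <= t < 2 * pi, cos t = u & sin t = v].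
  exists t; split => //; rewrite ct st -/m.
  apply/eqP; rewrite eq_complex/= !mul0r subr0 addr0 /u /v.
  have mn0 := lt0r_neq0 m0.
  by rewrite ![m * _]mulrC !divfK// !eqxx.
have sqv : Num.sqrt (1 - u ^+ 2) = `|v| by rewrite -uv addrAC subrr add0r sqrtr_sqr.
have au0 := acos_ge0 u1; have aupi := acos_lepi u1.
have pi0 := pi_gt0 R.
have [v0|v0] := leP 0 v.
  exists (acos u); rewrite acosK ?in_itv// sin_acos// sqv ger0_norm//.
  by split => //; apply/andP; split; lra.
(* Below the real axis the reflected angle is taken; it is less than 2 pi because [u = 1] would
   force [v = 0]. *)
exists (pi *+ 2 - acos u); rewrite [pi *+ 2 - _]addrC cosD2pi sinD2pi cosN sinN.
rewrite acosK ?in_itv// sin_acos// sqv ltr0_norm// opprK; split => //.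
rewrite [pi *+ 2]mulr2n; apply/andP; split; first lra.
suff : 0 < acos u by lra.
apply: acos_gt0; case/andP: u1 => -> u1 /=.
rewrite lt_def u1 andbT eq_sym; apply: contraTneq v0 => u_eq.
have /eqP : v ^+ 2 = 0 by move: uv; rewrite u_eq expr1n; lra.
by rewrite sqrf_eq0 => /eqP ->; rewrite ltxx.
Qed.

(** The value 0 is also the default of [xget], so it is informative only because a polar form
    exists. *)
Lemma arg_eq0 w : w != 0 -> arg w = 0 -> exists2 t, 0 < t & w = t%:C.
Proof.
move=> w0; rewrite /arg => a0; exists (modulus w); first by rewrite normc_gt0.
have := xgetPex 0 (polar_exists w0); rewrite a0 => -[_ ->].
by rewrite cos0 sin0 {2}(_ : 1 +i* 0 = 1)// mulr1 normc_real ger0_norm ?normc_ge0.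
Qed.

End Argument.

Section Triangle.
Variables (R : realType) (c : R[i]).
Hypothesis Imc : 0 < complex.Im c.
Implicit Types (w v : R[i]).

Definition affine_functional (phi : R[i] -> R) :=
  exists A B C : R, phi = fun w => A * complex.Re w + B * complex.Im w + C.

(* Positive multiples of the barycentric coordinates with respect to 1 and 0:
   side0 vanishes on the line through 0 and c, and side1 on the line through 1
   and c. *)
Definition side0 w := complex.Im c * complex.Re w - complex.Re c * complex.Im w.
Definition side1 w :=
  complex.Im c * (1 - complex.Re w) - (1 - complex.Re c) * complex.Im w.

Lemma affine_side0 : affine_functional side0.
Proof.
exists (complex.Im c), (- complex.Re c), 0; apply/funext => w; rewrite /side0; ring.
Qed.

Lemma affine_side1 : affine_functional side1.
Proof.
exists (- complex.Im c), (- (1 - complex.Re c)), (complex.Im c).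
by apply/funext => w; rewrite /side1; ring.
Qed.

Lemma affine_Im : affine_functional (@complex.Im R).
Proof. by exists 0, 1, 0; apply/funext => w /=; ring. Qed.

Lemma affine_functional_comb phi (t u v : R) (x y w : R[i]) :
  affine_functional phi -> t + u + v = 1 ->
  phi (t%:C * x + u%:C * y + v%:C * w) = t * phi x + u * phi y + v * phi w.
Proof.
move=> [A [B [C ->]]] tuv; rewrite !ReD !ImD !ReRl !ImRl.
rewrite -[X in _ + X = _](mul1r C) -tuv.
by ring.
Qed.

Lemma affine_functional_lip phi : affine_functional phi ->
  exists2 K : R, 0 < K & forall x y, `|phi x - phi y| <= K * modulus (x - y).
Proof.
move=> [A [B [C ->]]]; exists (`|A| + `|B| + 1) => [|x y].
  by rewrite ltr_wpDl ?addr_ge0.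
have -> : A * complex.Re x + B * complex.Im x + C - (A * complex.Re y + B * complex.Im y + C)
   = A * complex.Re (x - y) + B * complex.Im (x - y).
  by case: x => a b; case: y => a' b' /=; ring.
apply: le_trans (ler_normD _ _) _; rewrite !normrM.
have := normc_ge0 (x - y).
have := ler_wpM2l (normr_ge0 A) (normc_Re (x - y)).
have := ler_wpM2l (normr_ge0 B) (normc_Im (x - y)).
lra.
Qed.

Lemma triangleP w :
  triangle 0 1 c w <-> [/\ 0 <= side0 w, 0 <= side1 w & 0 <= complex.Im w].
Proof.
split=> [[t [u [v [[t0 u0 v0 tuv] ->]]]]|[w0 w1 w2]].
  rewrite (affine_functional_comb _ _ _ affine_side0)//.
  rewrite (affine_functional_comb _ _ _ affine_side1)//.
  rewrite (affine_functional_comb _ _ _ affine_Im)//.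
  rewrite /side0 /side1 /= ?(mulr0, mulr1, subr0, subrr, add0r, addr0).
  by split; [have := mulr_ge0 u0 (ltW Imc)|have := mulr_ge0 t0 (ltW Imc)
    |have := mulr_ge0 v0 (ltW Imc)]; lra.
exists (side1 w / complex.Im c), (side0 w / complex.Im c), (complex.Im w / complex.Im c).
split; first (split; rewrite ?divr_ge0 ?(ltW Imc)//).
  by rewrite /side0 /side1; field; rewrite gt_eqF.
apply/eqP; rewrite eq_complex !ReD !ImD !ReRl !ImRl /= /side0 /side1.
by apply/andP; split; apply/eqP; field; rewrite gt_eqF.
Qed.

Lemma triangle_comb (t u v : R) (x y w : R[i]) :
  0 <= t -> 0 <= u -> 0 <= v -> t + u + v = 1 ->
  triangle 0 1 c x -> triangle 0 1 c y -> triangle 0 1 c w ->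
  triangle 0 1 c (t%:C * x + u%:C * y + v%:C * w).
Proof.
move=> t0 u0 v0 tuv /triangleP[x0 x1 x2] /triangleP[y0 y1 y2] /triangleP[w0 w1 w2].
apply/triangleP; split.
- by rewrite (affine_functional_comb _ _ _ affine_side0)// !addr_ge0 ?mulr_ge0.
- by rewrite (affine_functional_comb _ _ _ affine_side1)// !addr_ge0 ?mulr_ge0.
- by rewrite (affine_functional_comb _ _ _ affine_Im)// !addr_ge0 ?mulr_ge0.
Qed.

Lemma triangle_closed w :
  (forall e : R, 0 < e -> exists2 v, triangle 0 1 c v & modulus (w - v) < e) ->
  triangle 0 1 c w.
Proof.
move=> H.
have key phi : affine_functional phi -> (forall v, triangle 0 1 c v -> 0 <= phi v) ->
    0 <= phi w.
  move=> /affine_functional_lip[K K0 phiK] phi0; rewrite leNgt; apply/negP => neg.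
  have [|v Tv wv] := H (- phi w / K); first by rewrite divr_gt0// oppr_gt0.
  have := phi0 _ Tv; have := phiK w v; rewrite ler_norml => /andP[lo _].
  by move: wv; rewrite ltr_pdivlMr//; lra.
apply/triangleP; split; apply: key.
- exact: affine_side0.
- by move=> v /triangleP[].
- exact: affine_side1.
- by move=> v /triangleP[].
- exact: affine_Im.
- by move=> v /triangleP[].
Qed.

(** From an interior point a short move against the gradient [A +i* B] stays in the triangle and
    strictly lowers [phi], which was therefore positive. *)
Lemma interior_affine_gt0 phi w : affine_functional phi ->
  (forall v, triangle 0 1 c v -> 0 <= phi v) -> (exists v, phi v != phi w) ->
  (triangle 0 1 c)° w -> 0 < phi w.
Proof.
move=> [A [B [C phiE]]] phi0 [v pv] /interior_normcP[e e0 wT].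
have AB : 0 < A ^+ 2 + B ^+ 2.
  rewrite lt_def addr_ge0 ?sqr_ge0// andbT; apply: contraNneq pv => AB0.
  have /eqP : A ^+ 2 = 0 by have := sqr_ge0 A; have := sqr_ge0 B; lra.
  have /eqP : B ^+ 2 = 0 by have := sqr_ge0 A; have := sqr_ge0 B; lra.
  by rewrite !sqrf_eq0 phiE => /eqP-> /eqP->; rewrite !mul0r.
pose m := modulus (A +i* B).
have m0 : 0 <= m by exact: normc_ge0.
pose eta := e / (m + 1).
have eta0 : 0 < eta by rewrite divr_gt0// ltr_wpDl.
have : triangle 0 1 c (w - eta%:C * (A +i* B)).
  apply: wT; rewrite opprB addrC subrK normcM normc_real gtr0_norm// -/m /eta.
  rewrite mulrAC ltr_pdivrMr; last by rewrite ltr_wpDl.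
  by rewrite mulrDr mulr1 ltrDl.
move=> /phi0; rewrite phiE.
have -> : complex.Re (w - eta%:C * (A +i* B)) = complex.Re w - eta * A.
  by case: (w) => a b /=; ring.
have -> : complex.Im (w - eta%:C * (A +i* B)) = complex.Im w - eta * B.
  by case: (w) => a b /=; ring.
have := mulr_gt0 eta0 AB; lra.
Qed.

Lemma triangle0 : triangle 0 1 c 0.
Proof. by apply/triangleP; rewrite /side0 /side1 /=; split; have := Imc; lra. Qed.

Lemma triangle_mem_c : triangle 0 1 c c.
Proof. by apply/triangleP; rewrite /side0 /side1 /=; split; have := Imc; lra. Qed.

Lemma interior_triangle w : (triangle 0 1 c)° w ->
  [/\ 0 < side0 w, 0 < side1 w & 0 < complex.Im w].
Proof.
have nc (phi : R[i] -> R) (x y : R[i]) : phi x != phi y -> exists v, phi v != phi w.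
  move=> xy; have [xw|xw] := eqVneq (phi x) (phi w); last by exists x.
  by exists y; rewrite -xw eq_sym.
move=> wT; split; apply: interior_affine_gt0 wT => //.
- exact: affine_side0.
- by move=> v /triangleP[].
- by apply: (nc side0 0 1); rewrite /side0 /=; apply/eqP; have := Imc; lra.
- exact: affine_side1.
- by move=> v /triangleP[].
- by apply: (nc side1 0 1); rewrite /side1 /=; apply/eqP; have := Imc; lra.
- exact: affine_Im.
- by move=> v /triangleP[].
- by apply: (nc (@complex.Im R) 0 c); rewrite /=; apply/eqP; have := Imc; lra.
Qed.

Lemma triangle_inball : exists c0, exists2 rho : R, 0 < rho &
  forall w, modulus (c0 - w) < rho -> triangle 0 1 c w.
Proof.
have [K0 K00 lip0] := affine_functional_lip affine_side0.
have [K1 K10 lip1] := affine_functional_lip affine_side1.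
(* At the centroid all three functionals equal a third of [Im c]. Below, [K] dominates their
   Lipschitz constants, the summand 1 being that of [Im]. *)
pose c0 := (3^-1)%:C * 0 + (3^-1)%:C * 1 + (3^-1)%:C * c.
pose K := K0 + K1 + 1.
have K_gt0 : 0 < K by rewrite /K; lra.
exists c0, (complex.Im c / (3 * K)) => [|w]; first by rewrite divr_gt0 ?mulr_gt0.
rewrite ltr_pdivlMr ?mulr_gt0// => cw.
have third : 3^-1 + 3^-1 + 3^-1 = 1 :> R by lra.
have := lip0 c0 w; have := lip1 c0 w; have := normc_Im (c0 - w).
rewrite {3 5}/c0 (affine_functional_comb _ _ _ affine_side0)//.
rewrite (affine_functional_comb _ _ _ affine_side1)//.
have -> : complex.Im (c0 - w) = complex.Im c / 3 - complex.Im w.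
  by rewrite /c0 !ImD !ImRl /=; case: (w) => ? ? /=; lra.
rewrite !ler_norml => /andP[_ ineq] /andP[_ ineq1] /andP[_ ineq0].
have m0 := normc_ge0 (c0 - w).
move: cw; rewrite /K => cw.
have : 0 <= K0 * modulus (c0 - w) by rewrite mulr_ge0// ltW.
have : 0 <= K1 * modulus (c0 - w) by rewrite mulr_ge0// ltW.
move=> p1 p0; apply/triangleP.
move: ineq1 ineq0; rewrite {1 2 3}/side0 {1 2 3}/side1 /=.
by move=> ineq1 ineq0; split; lra.
Qed.

(** By convexity, shrinking the ball inside the triangle towards a given point [w] yields interior
    points arbitrarily close to [w]. *)
Lemma closure_interior_triangle : closure (triangle 0 1 c)° = triangle 0 1 c.
Proof.
apply/seteqP; split => w.
  move=> /closure_normcP cw; apply: triangle_closed => e /cw[v Tv wv].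
  by exists v => //; exact: interior_subset Tv.
move=> Tw; apply/closure_normcP => e e0.
have [c0 [rho rho0 Hc0]] := triangle_inball.
pose m := modulus (w - c0).
have m0 : 0 <= m by exact: normc_ge0.
pose t := Num.min 1 (e / (m + 1)).
have t0 : 0 < t by rewrite lt_min ltr01 divr_gt0// ltr_wpDl.
have t1 : t <= 1 by rewrite ge_min lexx.
exists ((1 - t)%:C * w + t%:C * c0); last first.
  have -> : w - ((1 - t)%:C * w + t%:C * c0) = t%:C * (w - c0).
    by rewrite rmorphB/=; ring.
  rewrite normcM normc_real gtr0_norm// -/m.
  apply: (@le_lt_trans _ _ (e / (m + 1) * m)).
    by rewrite ler_wpM2r// ge_min lexx orbT.
  rewrite mulrAC ltr_pdivrMr; last by rewrite ltr_wpDl.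
  by rewrite mulrDr mulr1 ltrDl.
apply/interior_normcP; exists (t * rho); first by rewrite mulr_gt0.
move=> y; set b := (X in modulus (X - y)) => yb.
pose y' := c0 + t^-1%:C * (y - b).
have yE : y = (1 - t)%:C * w + t%:C * y' + 0%:C * 0.
  rewrite /y' /b mulrDr [t%:C * (_ * _)]mulrA -rmorphM/= divff ?gt_eqF//.
  by rewrite rmorph1 rmorph0 rmorphB/=; ring.
rewrite yE; apply: triangle_comb; rewrite ?subr_ge0 ?(ltW t0)//.
- by rewrite addr0 subrK.
- apply: Hc0; rewrite /y' opprD addrA subrr add0r normcN normcM normc_real.
  rewrite gtr0_norm ?invr_gt0// normc_distC mulrC ltr_pdivrMr//.
  by rewrite [rho * t]mulrC.
- exact: triangle0.
Qed.

Lemma side1_eq0 w : triangle 0 1 c w -> side1 w = 0 -> segment c 1 w.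
Proof.
move=> [t [u [v [[t0 u0 v0 tuv] ->]]]].
rewrite (affine_functional_comb _ _ _ affine_side1)// {1 2 3}/side1 /= => s0.
have tE : t = 0 by apply: (mulIf (lt0r_neq0 Imc)); rewrite mul0r; lra.
exists u; split; first by apply/andP; split; lra.
have -> : v = 1 - u by lra.
by rewrite tE rmorph0 rmorphB/= rmorph1; ring.
Qed.

Lemma side0_eq0 w : triangle 0 1 c w -> side0 w = 0 -> segment c 0 w.
Proof.
move=> [t [u [v [[t0 u0 v0 tuv] ->]]]].
rewrite (affine_functional_comb _ _ _ affine_side0)// {1 2 3}/side0 /= => s0.
have uE : u = 0 by apply: (mulIf (lt0r_neq0 Imc)); rewrite mul0r; lra.
exists t; split; first by apply/andP; split; lra.
have -> : v = 1 - t by lra.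
by rewrite uE rmorph0 rmorphB/= rmorph1; ring.
Qed.

End Triangle.

(** * Geometry of basic figures *)

Section BasicFigureGeometry.
Variables (R : realType) (l : nat) (z : l.+1.-tuple R[i]) (q : nat).
Hypothesis z_0 : z`_0 = 0.
Hypothesis z_l : z`_l = 1.
Hypothesis Im_zq : 0 < complex.Im z`_q.
Hypothesis basic : basic_figure z q.
Implicit Types (w v : R[i]) (j : nat).

Local Notation c := (z`_q).
Local Notation T := (triangle 0 1 c).

Lemma sim_coefE j : sim_coef z j = z`_j - z`_j.-1.
Proof. by rewrite /sim_coef z_0 z_l subr0 divr1. Qed.

Lemma simE j w : sim z j w = sim_coef z j * w + z`_j.-1.
Proof. by rewrite /sim z_0 subr0. Qed.

Lemma sim_at0 j : sim z j 0 = z`_j.-1.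
Proof. by rewrite simE mulr0 add0r. Qed.

Lemma sim_at1 j : sim z j 1 = z`_j.
Proof. by rewrite simE sim_coefE mulr1 subrK. Qed.

Lemma sim_sub j w v : sim z j w - sim z j v = sim_coef z j * (w - v).
Proof. by rewrite !simE; ring. Qed.

Lemma sim_dist j w v :
  modulus (sim z j w - sim z j v) = sim_ratio z j * modulus (w - v).
Proof. by rewrite sim_sub normcM. Qed.

Lemma sim_ratio_gt0 j : (1 <= j <= l)%N -> 0 < sim_ratio z j.
Proof. by move=> /(sim_contractive basic)/andP[]. Qed.

Lemma sim_coef_neq0 j : (1 <= j <= l)%N -> sim_coef z j != 0.
Proof. by move=> /sim_ratio_gt0; rewrite normc_gt0. Qed.

Lemma sim_surj j v : (1 <= j <= l)%N -> exists w, sim z j w = v.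
Proof.
move=> /sim_coef_neq0 a0; exists ((v - z`_j.-1) / sim_coef z j).
by rewrite simE mulrC divfK// subrK.
Qed.

Lemma sim_inj j w v : (1 <= j <= l)%N -> sim z j w = sim z j v -> w = v.
Proof.
move=> /sim_coef_neq0 a0; rewrite !simE => /addIr; exact: mulfI.
Qed.

Lemma sim_comb j (t u v : R) (x y w : R[i]) : t + u + v = 1 ->
  sim z j (t%:C * x + u%:C * y + v%:C * w) =
  t%:C * sim z j x + u%:C * sim z j y + v%:C * sim z j w.
Proof.
move=> tuv; have : (t%:C + u%:C + v%:C) * z`_j.-1 = z`_j.-1.
  by rewrite -!rmorphD/= tuv rmorph1 mul1r.
rewrite !simE => {1}<-; ring.
Qed.

Lemma Pi0E : Pi0 z q = T°.
Proof. by rewrite /Pi0 z_0 z_l. Qed.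

Lemma Pi1E : Pi1 z q = T.
Proof. by rewrite /Pi1 Pi0E closure_interior_triangle. Qed.

Lemma segment01P w : segment 0 1 w -> exists2 t : R, 0 <= t <= 1 & w = t%:C.
Proof. by move=> [t [t01 ->]]; exists t => //; rewrite subr0 mulr1 add0r. Qed.

Lemma segment_triangle w : segment 0 1 w -> T w.
Proof.
move=> /segment01P[t /andP[t0 t1] ->]; exists (1 - t), t, 0; split.
  by split; rewrite ?subr_ge0//; ring.
by rewrite mulr0 rmorph0; ring.
Qed.

Lemma vertexP j : (j <= l)%N -> [\/ z`_j = c, segment 0 1 z`_j | T° z`_j].
Proof.
move=> /(vertices_in_Pi basic) [[|]|].
- by move=> ->; constructor 1.
- by rewrite z_0 z_l; constructor 2.
- by rewrite Pi0E; constructor 3.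
Qed.

Lemma vertex_triangle j : (j <= l)%N -> T z`_j.
Proof.
move=> /vertexP[->|/segment_triangle //|]; first exact: triangle_mem_c.
exact: interior_subset.
Qed.

Lemma apex_triangle j : (1 <= j <= l)%N -> T (sim z j c).
Proof. by move=> /(apex_in_Pi1 basic); rewrite Pi1E. Qed.

Lemma sim_triangle j w : (1 <= j <= l)%N -> T w -> T (sim z j w).
Proof.
move=> jl [t [u [v [[t0 u0 v0 tuv] ->]]]]; rewrite sim_comb// sim_at0 sim_at1.
case/andP: (jl) => j1 jl'; apply: triangle_comb => //.
- by apply: vertex_triangle; rewrite (leq_trans (leq_pred _)).
- exact: vertex_triangle.
- exact: apex_triangle.
Qed.

Lemma sim_interior j w : (1 <= j <= l)%N -> T° w -> T° (sim z j w).
Proof.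
move=> jl /interior_normcP[e e0 wT]; apply/interior_normcP.
exists (sim_ratio z j * e); first by rewrite mulr_gt0 ?sim_ratio_gt0.
move=> y; have [y' <-] := sim_surj y jl.
rewrite sim_dist ltr_pM2l ?sim_ratio_gt0// => /wT; exact: sim_triangle.
Qed.

(** The vertices of index 0, 1, [l.-1] and [l] lie on the real axis, and the apex does not. *)
Lemma apex_index_bounds : (1 < q)%N && (q.+1 < l)%N.
Proof.
have Im_seg w : segment 0 1 w -> complex.Im w = 0.
  by move=> /segment01P[t _ ->].
have q0 : q != 0%N by apply: contraTneq Im_zq => ->; rewrite z_0 /= ltxx.
have q1 : q != 1%N.
  apply: contraTneq Im_zq => ->; rewrite Im_seg ?ltxx//.
  by have := first_on_base basic; rewrite z_0 z_l.
have ql : q != l by apply: contraTneq Im_zq => ->; rewrite z_l /= ltxx.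
have ql1 : q != l.-1.
  apply: contraTneq Im_zq => ->; rewrite Im_seg ?ltxx//.
  by have := last_on_base basic; rewrite z_0 z_l.
have := apex_index basic; case: (l) q0 q1 ql ql1 => [|n] /= *; lia.
Qed.

Lemma l_gt0 : (0 < l)%N.
Proof. by have := apex_index_bounds; case: (l) => //; rewrite andbF. Qed.

(** As [z_1] is on the base, [S_1] is a homothety centred at 0; the absence of rotation keeps all
    its iterates of the apex on one ray. *)
Lemma sim_coef_first : sim_coef z 1 = (sim_ratio z 1)%:C.
Proof.
rewrite /sim_ratio sim_coefE /= z_0 subr0.
have := first_on_base basic; rewrite z_0 z_l => /segment01P[t /andP[t0 _] ->].
by rewrite normc_real ger0_norm.
Qed.

Lemma sim_coef_last : sim_coef z l = (sim_ratio z l)%:C.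
Proof.
rewrite /sim_ratio sim_coefE z_l.
have := last_on_base basic; rewrite z_0 z_l => /segment01P[t /andP[_ t1] ->].
have -> : 1 - t%:C = (1 - t)%:C :> R[i] by rewrite rmorphB.
by rewrite normc_real ger0_norm ?subr_ge0.
Qed.

Lemma sim_first w : sim z 1 w = (sim_ratio z 1)%:C * w.
Proof. by rewrite simE sim_coef_first /= z_0 addr0. Qed.

Lemma sim_last w : sim z l w - 1 = (sim_ratio z l)%:C * (w - 1).
Proof. by rewrite -[X in _ - X]z_l -sim_at1 sim_sub sim_coef_last. Qed.

Lemma interior_not_shared j k w v : (1 <= j <= l)%N -> (1 <= k <= l)%N ->
  j <> k -> T° w -> T° v -> sim z j w = sim z k v -> False.
Proof.
move=> jl kl jk Tw Tv jkE.
have : ((sim z j @` Pi0 z q) `&` (sim z k @` Pi0 z q)) (sim z j w).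
  by rewrite Pi0E; split; [exists w|exists v].
by rewrite (Pi0_disjoint basic).
Qed.

Lemma interior_point : exists w, T° w.
Proof.
have [c0 [rho rho0 H]] := triangle_inball Im_zq.
by exists c0; apply/interior_normcP; exists rho.
Qed.

(* If z_j = 1 then S_j and S_l are similitudes with the same centre, hence they
   commute, and their images of the open triangle overlap. *)
Lemma vertex_neq1 j : (j < l)%N -> z`_j != 1.
Proof.
case: j => [_|j jl]; first by rewrite z_0 eq_sym oner_eq0.
apply/eqP => zj; have [w Tw] := interior_point.
have jl1 : (1 <= j.+1 <= l)%N by rewrite /= ltnW.
have ll1 : (1 <= l <= l)%N by rewrite l_gt0 leqnn.
have jl_neq : j.+1 <> l by move=> jE; rewrite jE ltnn in jl.
apply: (interior_not_shared jl1 ll1 jl_neq (sim_interior ll1 Tw)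
  (sim_interior jl1 Tw)).
have cj v : sim z j.+1 v = sim_coef z j.+1 * (v - 1) + 1.
  by rewrite -[X in _ + X]zj -(sim_at1 j.+1) -sim_sub subrK.
have cl v : sim z l v = sim_coef z l * (v - 1) + 1.
  by rewrite -[X in _ + X]z_l -(sim_at1 l) -sim_sub subrK.
by rewrite (cj (sim z l w)) (cl (sim z _ w)) (cj w) (cl w); ring.
Qed.

(** The mirror case: if [z_j] were 0, then [S_(j+1)] and [S_1] would both fix 0 and so commute. *)
Lemma vertex_neq0 j : (0 < j)%N -> (j <= l)%N -> z`_j != 0.
Proof.
move=> j0; rewrite leq_eqVlt => /orP[/eqP->|jl]; first by rewrite z_l oner_eq0.
apply/eqP => zj; have [w Tw] := interior_point.
have jl1 : (1 <= j.+1 <= l)%N by [].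
have ll1 : (1 <= 1 <= l)%N by exact: l_gt0.
have j1_neq : j.+1 <> 1%N by move=> [jE]; rewrite jE in j0.
apply: (interior_not_shared jl1 ll1 j1_neq (sim_interior ll1 Tw)
  (sim_interior jl1 Tw)).
by rewrite !simE /= zj z_0; ring.
Qed.

(** [S_q] already sends 1 to the apex and [S_(q+1)] sends 0 there, so injectivity forbids sending
    the apex there too. *)
Lemma sim_c_neq_c j : (1 <= j <= l)%N -> (j == q) || (j == q.+1) -> sim z j c != c.
Proof.
move=> jl jq; apply/eqP => jc.
have [q1 q2] := andP apex_index_bounds.
have c0 : c != 0 by apply: contraTneq Im_zq => ->; rewrite ltxx.
have c1 : c != 1 by apply: contraTneq Im_zq => ->; rewrite ltxx.
case/orP: jq jc jl => /eqP-> jc jl.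
  by move/eqP: c1; apply; apply: (sim_inj jl); rewrite jc sim_at1.
by move/eqP: c0; apply; apply: (sim_inj jl); rewrite jc sim_at0.
Qed.

(** * Vertices and pieces relative to the two sides at the apex *)

Lemma triangle_apex w : T w -> complex.Im w = complex.Im c -> w = c.
Proof.
move=> Tw wc; have := Tw => /(triangleP Im_zq)[s0 s1 _].
apply/eqP; rewrite eq_complex wc eqxx andbT; apply/eqP.
move: s0 s1; rewrite /side0 /side1 wc => s0 s1.
apply: (mulfI (lt0r_neq0 Im_zq)); lra.
Qed.

Lemma side1_vertex j : (j < l)%N -> z`_j = c \/ 0 < side1 c z`_j.
Proof.
move=> jl; have := vertex_neq1 jl.
case: (vertexP (ltnW jl)) => [->|/segment01P[t /andP[_ t1] ->] tn1|/interior_triangle-/(_ Im_zq)[]].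
- by left.
- right; rewrite /side1 /= mulr0 subr0 mulr_gt0// subr_gt0 lt_neqAle t1 andbT.
  by apply: contraNneq tn1 => ->; rewrite rmorph1.
- by right.
Qed.

Lemma side0_vertex j : (0 < j)%N -> (j <= l)%N -> z`_j = c \/ 0 < side0 c z`_j.
Proof.
move=> j0 jl; have := vertex_neq0 j0 jl.
case: (vertexP jl) => [->|/segment01P[t /andP[t0 _] ->] tn0|/interior_triangle-/(_ Im_zq)[]].
- by left.
- right; rewrite /side0 /= mulr0 subr0 mulr_gt0// lt_neqAle t0 andbT eq_sym.
  by apply: contraNneq tn0 => ->; rewrite rmorph0.
- by right.
Qed.

Lemma generic_apex_off_sides j : (1 <= j <= l)%N -> j \notin [:: 1; l; q; q.+1]%N ->
  0 < side0 c (sim z j c) /\ 0 < side1 c (sim z j c).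
Proof.
move=> jl jn; have Tj := apex_triangle jl.
have := Tj => /(triangleP Im_zq)[s0 s1 _].
have off : ~ (segment c 0 (sim z j c) \/ segment c 1 (sim z j c)).
  move=> seg; suff : ((sim z j @` Pi1 z q) `&`
      (segment c z`_0 `|` segment c z`_l)) (sim z j c).
    by rewrite (Pi1_off_sides basic).
  by rewrite z_0 z_l Pi1E; split => //; exists c => //; exact: triangle_mem_c.
split; rewrite lt_def ?s0 ?s1 andbT; apply/eqP => sE; apply: off.
- by left; exact: side0_eq0.
- by right; exact: side1_eq0.
Qed.

Lemma segment_from_c (b : R[i]) w : w != c -> segment c b w ->
  exists2 t : R, 0 < t & w - c = t%:C * (b - c).
Proof.
move=> wc [t [/andP[t0 t1] wE]]; exists t; last by rewrite wE addrAC subrr add0r.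
rewrite lt_def t0 andbT; apply: contraNneq wc => tE.
by rewrite wE tE rmorph0 mul0r addr0.
Qed.

(** The indices exempt from [Pi1_off_sides] are treated apart. [S_1] moves the apex along the side
    to 0. For [S_q], contact with the side to 1 makes the linear part a half-turn, which puts
    [z_(q-1)] at the height of the apex but away from it, outside the triangle. For [S_(q+1)],
    contact means [eta2 = 0]. *)
Lemma side1_apex j : 0 < eta2 z q -> (1 <= j)%N -> (j < l)%N ->
  0 < side1 c (sim z j c).
Proof.
move=> eta20 j1 jl; have jl' : (1 <= j <= l)%N by rewrite j1 ltnW.
have [q1 q2] := andP apex_index_bounds.
have Tj := apex_triangle jl'.
have := Tj => /(triangleP Im_zq)[_ s1 _].
have [jin|/(generic_apex_off_sides jl')[]//] := boolP (j \in [:: 1; l; q; q.+1]%N).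
rewrite lt_def s1 andbT; apply/eqP => /(side1_eq0 Im_zq Tj) seg.
move: jin; rewrite !inE => /or4P[/eqP jE|/eqP jE|/eqP jE|/eqP jE].
- have := side1_eq0; move: seg; rewrite jE sim_first => -[t [/andP[t0 t1]]].
  move=> /(congr1 (side1 c)).
  have -> : side1 c (c + t%:C * (1 - c)) = 0.
    by rewrite /side1; case: (c) => a b /=; ring.
  rewrite /side1 ReRl ImRl => E.
  have : complex.Im c * (1 - sim_ratio z 1) = 0 by rewrite -E; ring.
  have /andP[_ r1] : 0 < sim_ratio z 1 < 1.
    by apply: (sim_contractive basic); rewrite (leq_trans j1 (ltnW jl)).
  by move/eqP; rewrite mulf_eq0 !gt_eqF// subr_gt0.
- by rewrite jE ltnn in jl.
- have [|t t0 E] := segment_from_c _ seg; first by apply: sim_c_neq_c; rewrite // jE eqxx.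
  have zjc : z`_j = c by rewrite jE.
  have aE : sim_coef z j = (- t)%:C.
    have c1 : c - 1 != 0.
      by rewrite subr_eq0; apply: contraTneq Im_zq => ->; rewrite ltxx.
    by apply: (mulIf c1); rewrite -sim_sub sim_at1 zjc E rmorphN/=; ring.
  have zE : z`_j.-1 = c + t%:C.
    by rewrite -sim_at0 -[LHS](subrK (sim z j 1)) sim_sub sim_at1 zjc aE rmorphN/=; ring.
  have : z`_j.-1 = c.
    apply: triangle_apex; last by rewrite zE ImD addr0.
    by apply: vertex_triangle; rewrite (leq_trans (leq_pred _))// ltnW.
  rewrite zE -[RHS]addr0 => /addrI /eqP.
  by rewrite eq_complex /= eqxx andbT gt_eqF.
- have [|t t0 E] := segment_from_c _ seg.
    by apply: sim_c_neq_c; rewrite // jE eqxx orbT.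
  move: eta20; rewrite /eta2 z_l -[X in sim z X _]jE E.
  have c1 : 1 - c != 0.
    by rewrite subr_eq0 eq_sym; apply: contraTneq Im_zq => ->; rewrite ltxx.
  rewrite invfM mulrCA divff// mulr1.
  have -> : t%:C^-1 = (t^-1)%:C by rewrite fmorphV.
  by rewrite arg_pos ?invr_gt0// ltxx.
Qed.

(** In the mirror image [S_q] and [S_(q+1)] exchange roles: contact of [S_q] contradicts [eta1 > 0],
    contact of [S_(q+1)] misplaces [z_(q+1)]. *)
Lemma side0_apex j : 0 < eta1 z q -> (1 < j)%N -> (j <= l)%N ->
  0 < side0 c (sim z j c).
Proof.
move=> eta10 j1 jl; have jl' : (1 <= j <= l)%N by rewrite (ltnW j1).
have [q1 q2] := andP apex_index_bounds.
have Tj := apex_triangle jl'.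
have := Tj => /(triangleP Im_zq)[s0 _ _].
have [jin|/(generic_apex_off_sides jl')[]//] := boolP (j \in [:: 1; l; q; q.+1]%N).
rewrite lt_def s0 andbT; apply/eqP => /(side0_eq0 Im_zq Tj) seg.
have c0 : c != 0 by apply: contraTneq Im_zq => ->; rewrite ltxx.
move: jin; rewrite !inE => /or4P[/eqP jE|/eqP jE|/eqP jE|/eqP jE].
- by rewrite jE in j1.
- move: seg; rewrite jE => -[t [/andP[t0 t1]]].
  move=> /(congr1 (side0 c)).
  have -> : side0 c (c + t%:C * (0 - c)) = 0.
    by rewrite /side0; case: (c) => a b /=; ring.
  have -> : sim z l c = (sim_ratio z l)%:C * (c - 1) + 1 by rewrite -sim_last subrK.
  rewrite /side0 ReD ImD ReRl ImRl => E.
  have : complex.Im c * (1 - sim_ratio z l) = 0.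
    by rewrite -E; case: (c) => a b /=; ring.
  have /andP[_ r1] : 0 < sim_ratio z l < 1.
    by apply: (sim_contractive basic); rewrite l_gt0 leqnn.
  by move/eqP; rewrite mulf_eq0 !gt_eqF// subr_gt0.
- have [|t t0 E] := segment_from_c _ seg; first by apply: sim_c_neq_c; rewrite // jE eqxx.
  move: eta10; rewrite /eta1 z_0 -[X in sim z X _]jE E.
  have c0' : 0 - c != 0 by rewrite sub0r oppr_eq0.
  by rewrite -mulrA divff// mulr1 arg_pos// ltxx.
- have [|t t0 E] := segment_from_c _ seg.
    by apply: sim_c_neq_c; rewrite // jE eqxx orbT.
  have zjc : z`_j.-1 = c by rewrite jE.
  have aE : sim_coef z j = (- t)%:C.
    by apply: (mulIf c0); rewrite -{1}[c]subr0 -sim_sub sim_at0 zjc E rmorphN/=; ring.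
  have zE : z`_j = c - t%:C.
    rewrite -sim_at1 -[LHS](subrK (sim z j 0)) sim_sub sim_at0 aE subr0 mulr1.
    by rewrite zjc rmorphN/=; ring.
  have : z`_j = c.
    apply: triangle_apex; last by rewrite zE; case: (c) => a b /=; ring.
    exact: vertex_triangle.
  rewrite zE -[RHS]addr0 => /addrI /eqP; rewrite oppr_eq0.
  by rewrite eq_complex /= eqxx andbT gt_eqF.
Qed.

(** [k] is a minimum of finitely many positive quotients; a point at the apex allows any constant
    and is given 1. *)
Lemma cone_constant (I : finType) (V : I -> R[i]) (phi : R[i] -> R) :
  (forall i, V i = c \/ 0 < phi (V i)) -> 0 <= phi c ->
  exists2 k : R, 0 < k & forall i, k * modulus (V i - c) <= phi (V i).
Proof.
move=> HV phic; pose kk i := if V i == c then 1 else phi (V i) / modulus (V i - c).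
have [|k /andP[k0 _] Hk] := @fin_common_gt0 R I kk.
  move=> i; rewrite /kk; case: eqVneq => [_|Vc]; first exact: ltr01.
  by case: (HV i) => [Vc'|?]; [rewrite Vc' eqxx in Vc|rewrite divr_gt0// normc_gt0 subr_eq0].
exists k => // i; have := Hk i; rewrite /kk.
case: eqVneq => [-> _|Vc]; first by rewrite subrr normc0 mulr0.
by rewrite ler_pdivlMr// normc_gt0 subr_eq0.
Qed.

(** The left side of the bound is convex and [phi] is affine, so the bound passes from the corners
    to the whole triangle. *)
Lemma cone_comb (phi : R[i] -> R) (k : R) (x y v w : R[i]) :
  affine_functional phi -> 0 < k -> triangle x y v w ->
  k * modulus (x - c) <= phi x -> k * modulus (y - c) <= phi y ->
  k * modulus (v - c) <= phi v -> k * modulus (w - c) <= phi w.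
Proof.
move=> aphi k0 [t [u [s [[t0 u0 s0 tus] ->]]]] px py pv.
rewrite affine_functional_comb//.
apply: (@le_trans _ _ (k * (t * modulus (x - c) + u * modulus (y - c) +
   s * modulus (v - c)))).
  rewrite ler_pM2l//.
  have -> : t%:C * x + u%:C * y + s%:C * v - c =
      t%:C * (x - c) + u%:C * (y - c) + s%:C * (v - c).
    have : (t%:C + u%:C + s%:C) * c = c by rewrite -!rmorphD/= tus rmorph1 mul1r.
    by move=> {1}<-; ring.
  apply: le_trans (normcD _ _) _; apply: lerD.
    apply: le_trans (normcD _ _) _.
    by rewrite !normcM !normc_real !ger0_norm.
  by rewrite normcM normc_real ger0_norm.
have := ler_wpM2l t0 px; have := ler_wpM2l u0 py; have := ler_wpM2l s0 pv.
lra.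
Qed.

Lemma sim_in_triangle j w : T w -> triangle z`_j.-1 z`_j (sim z j c) (sim z j w).
Proof.
move=> [t [u [v [tuv ->]]]]; exists t, u, v; split => //.
by case: tuv => _ _ _ ?; rewrite sim_comb// sim_at0 sim_at1.
Qed.

(* Away from S_l, the arc leaves the apex within a cone transversal to the
   side joining the apex to 1. *)
Lemma side1_cone : 0 < eta2 z q -> exists2 k : R, 0 < k &
  forall j w, (1 <= j)%N -> (j < l)%N -> T w ->
    k * modulus (sim z j w - c) <= side1 c (sim z j w).
Proof.
move=> eta20.
have phic : 0 <= side1 c c by rewrite /side1; lra.
have [|k1 k10 H1] := @cone_constant 'I_l (fun i => z`_i) (side1 c) _ phic.
  by move=> i; apply: side1_vertex.
have [|k2 k20 H2] := @cone_constant 'I_l.-1 (fun i => sim z i.+1 c) (side1 c) _ phic.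
  move=> i; right; apply: side1_apex => //.
  by rewrite -[ltnRHS](prednK l_gt0) ltnS.
exists (Num.min k1 k2); first by rewrite lt_min k10.
move=> j w j1 jl Tw.
have m1 v : k1 * modulus (v - c) <= side1 c v ->
    Num.min k1 k2 * modulus (v - c) <= side1 c v.
  by apply: le_trans; rewrite ler_wpM2r ?normc_ge0// ge_min lexx.
have m2 v : k2 * modulus (v - c) <= side1 c v ->
    Num.min k1 k2 * modulus (v - c) <= side1 c v.
  by apply: le_trans; rewrite ler_wpM2r ?normc_ge0// ge_min lexx orbT.
apply: cone_comb (sim_in_triangle j Tw) _ _ _.
- exact: affine_side1.
- by rewrite lt_min k10.
- by apply: m1; have jl' := leq_ltn_trans (leq_pred j) jl; exact: (H1 (Ordinal jl')).
- by apply: m1; exact: (H1 (Ordinal jl)).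
- apply: m2; have jl' : (j.-1 < l.-1)%N by case: (j) (l) j1 jl => [|?] [|?].
  by have := H2 (Ordinal jl'); rewrite /= (prednK j1).
Qed.

(** Without [S_1], the corners [z_(j-1)] and [z_j] have positive index; [z_0] is the only vertex
    other than the apex where [side0] vanishes. *)
Lemma side0_cone : 0 < eta1 z q -> exists2 k : R, 0 < k &
  forall j w, (1 < j)%N -> (j <= l)%N -> T w ->
    k * modulus (sim z j w - c) <= side0 c (sim z j w).
Proof.
move=> eta10.
have phic : 0 <= side0 c c by rewrite /side0; lra.
have [|k1 k10 H1] := @cone_constant 'I_l (fun i => z`_i.+1) (side0 c) _ phic.
  by move=> i; apply: side0_vertex.
have [|k2 k20 H2] := @cone_constant 'I_l.-1 (fun i => sim z i.+2 c) (side0 c) _ phic.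
  move=> i; right; apply: side0_apex => //.
  by rewrite -[leqRHS](prednK l_gt0) ltnS.
exists (Num.min k1 k2); first by rewrite lt_min k10.
move=> j w j1 jl Tw.
have m1 v : k1 * modulus (v - c) <= side0 c v ->
    Num.min k1 k2 * modulus (v - c) <= side0 c v.
  by apply: le_trans; rewrite ler_wpM2r ?normc_ge0// ge_min lexx.
have m2 v : k2 * modulus (v - c) <= side0 c v ->
    Num.min k1 k2 * modulus (v - c) <= side0 c v.
  by apply: le_trans; rewrite ler_wpM2r ?normc_ge0// ge_min lexx orbT.
case: j j1 jl => [|[|j]]// _ jl.
apply: cone_comb (sim_in_triangle j.+2 Tw) _ _ _.
- exact: affine_side0.
- by rewrite lt_min k10.
- by apply: m1; exact: (H1 (Ordinal (ltnW jl))).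
- by apply: m1; exact: (H1 (Ordinal jl)).
- apply: m2; have jl' : (j < l.-1)%N by case: (l) jl.
  exact: (H2 (Ordinal jl')).
Qed.

End BasicFigureGeometry.

(** * The order and the measure of a self-similar arc *)

Section AttractorMeasure.
Variables (R : realType) (l : nat) (z : l.+1.-tuple R[i]) (q : nat).
Variables (Lam : set R[i]) (s : R).
Hypothesis z_0 : z`_0 = 0.
Hypothesis z_l : z`_l = 1.
Hypothesis Im_zq : 0 < complex.Im z`_q.
Hypothesis basic : basic_figure z q.
Hypothesis attr : attractor z Lam.

Local Notation c := (z`_q).
Local Notation T := (triangle 0 1 c).

Lemma attractor_stable j w : (1 <= j <= l)%N -> Lam w -> Lam (sim z j w).
Proof. by move=> jl Lw; case: attr => _ _ ->; exists j => //; exists w. Qed.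

Lemma attractor_cover w : Lam w ->
  exists j, (1 <= j <= l)%N /\ exists2 v, Lam v & sim z j v = w.
Proof. by case: attr => _ _ {1}-> [j /= jl [v Lv <-]]; exists j; split => //; exists v. Qed.

Lemma sim_ratio01 (j : 'I_l) : 0 < sim_ratio z j.+1 < 1.
Proof. by apply: (sim_contractive basic); rewrite ltn_ord. Qed.

Lemma attractor_triangle w : Lam w -> T w.
Proof.
have [_ cL _] := attr; have [B B0 LB] := compact_normc_bounded cL.
have [rho /andP[rho0 rho1] rrho] := fin_common_lt1 sim_ratio01.
have key n : forall v, Lam v -> exists2 u, T u & modulus (v - u) <= rho ^+ n * B.
  elim: n => [|n IH] v Lv.
    by exists 0; [exact: triangle0|rewrite subr0 mul1r LB].
  have [j [jl [v' Lv' <-]]] := attractor_cover Lv.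
  have [u Tu vu] := IH v' Lv'; exists (sim z j u).
    exact: (sim_triangle z_0 z_l Im_zq basic).
  rewrite (sim_dist z_0) exprS -mulrA; apply: ler_pM; rewrite ?normc_ge0//.
  by case: j jl => // j jl; exact: (rrho (Ordinal jl)).
move=> Lw; apply: triangle_closed => // e e0.
have [N HN] : exists N, forall n, (N <= n)%N -> rho ^+ n < e / B.
  by apply: expr_small; rewrite ?(ltW rho0)// divr_gt0.
have [u Tu wu] := key N w Lw; exists u => //.
by apply: le_lt_trans wu _; rewrite -ltr_pdivlMr// HN.
Qed.

(** The open set condition holds for the open triangle; computing the dimension as the Moran
    exponent [D] identifies [s] with [D]. *)
Lemma attractor_hausdorff : hausdorff_dim Lam = s%:E ->
  [/\ 0 < s, \sum_(j < l) sim_ratio z j.+1 `^ s = 1,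
    (0 < hausdorff_measure s Lam)%E & (hausdorff_measure s Lam < +oo)%E].
Proof.
have [[x0 Lx0] cL _] := attr.
have [|D D0 moran] := moran_exponent_exists sim_ratio01.
  rewrite card_ord; have := apex_index_bounds z_0 z_l Im_zq basic.
  by move=> /andP[q1 q2]; lia.
have [c0 Tc0] := interior_point Im_zq.
have [e e0 eT] := (interior_normcP _ _).1 Tc0.
have f_sim (j : 'I_l) w v : modulus (sim z j.+1 w - sim z j.+1 v) =
    sim_ratio z j.+1 * modulus (w - v) by exact: sim_dist.
have jl (j : 'I_l) : (1 <= j.+1 <= l)%N by rewrite ltn_ord.
have f_surj (j : 'I_l) v : exists w, sim z j.+1 w = v.
  exact: (sim_surj z_0 basic).
have Lst (j : 'I_l) w : Lam w -> Lam (sim z j.+1 w) by exact: attractor_stable.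
have Lcov w : Lam w -> exists j : 'I_l, (sim z j.+1 @` Lam) w.
  move=> /attractor_cover[[|j] [jl' [v Lv <-]]]; first by [].
  by exists (Ordinal jl'); exists v.
have Tst (j : 'I_l) w : T° w -> T° (sim z j.+1 w).
  exact: (sim_interior z_0 z_l Im_zq basic).
have Tdis (j k : 'I_l) : j != k ->
    (sim z j.+1 @` T°) `&` (sim z k.+1 @` T°) = set0.
  move=> jk; rewrite -(Pi0E q z_0 z_l); apply: (Pi0_disjoint basic) => // -[].
  by move/ord_inj/eqP; rewrite (negbTE jk).
(* With half the radius, every point of the ball is itself interior to the triangle. *)
have e20 : 0 < e / 2 by rewrite divr_gt0.
have Tball w : modulus (c0 - w) < e / 2 -> T° w.
  move=> cw; apply/interior_normcP; exists (e / 2) => // v wv; apply: eT.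
  by apply: le_lt_trans (normc_distD w _ _) _; lra.
have := hausdorff_dim_attractor f_sim f_surj sim_ratio01 Lst Lcov cL D0 moran
  Lx0 Tst Tdis e20 Tball.
move=> -> [<-]; split => //.
- exact: (hausdorff_attractor_gt0 f_sim f_surj sim_ratio01 Lst cL D0 moran
  Lx0 Tst Tdis e20 Tball).
- exact: (hausdorff_attractor_lty f_sim sim_ratio01 Lcov cL D0 moran).
Qed.

End AttractorMeasure.

(** * The real coordinate along an arc *)

Section ArcCoordinate.
Variables (R : realType) (Lam : set R[i]) (a b : R[i]).

(** Fixing one parametrization [g] with inverse [h] turns the order of the arc into the order of the
    reals. *)
Definition arc_coord (g : R -> R[i]) (h : R[i] -> R) : Prop :=
  [/\ arc_param a b Lam g, {within Lam, continuous h} & {in `[0, 1], cancel g h}].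

Variables (g : R -> R[i]) (h : R[i] -> R).
Hypothesis gh : arc_coord g h.

Lemma arc_param_mem t : t \in `[0, 1] -> Lam (g t).
Proof. by case: gh => -[[gL _ _] _ _ _ _] _ _ t01; exact: gL. Qed.

Lemma arc_paramK t : t \in `[0, 1] -> h (g t) = t.
Proof. by case: gh => _ _ ghK; exact: ghK. Qed.

Lemma arc_coordP x : Lam x -> h x \in `[0, 1] /\ g (h x) = x.
Proof.
case: (gh) => -[[_ _ gS] _ _ _ _] _ _ /gS[t t01 <-].
by rewrite arc_paramK.
Qed.

Lemma arc_coord_inj x y : Lam x -> Lam y -> h x = h y -> x = y.
Proof. by move=> /arc_coordP[_ {2}<-] /arc_coordP[_ {2}<-] ->. Qed.

Lemma arc_coord_start : h a = 0.
Proof.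
by case: (gh) => -[_ _ _ <- _] _ _; rewrite arc_paramK// in_itv/= lexx ler01.
Qed.

Lemma arc_coord_end : h b = 1.
Proof.
by case: (gh) => -[_ _ _ _ <-] _ _; rewrite arc_paramK// in_itv/= lexx ler01.
Qed.

Lemma arc_start_mem : Lam a.
Proof.
case: (gh) => -[_ _ _ <- _] _ _; apply: arc_param_mem.
by rewrite in_itv/= lexx ler01.
Qed.

Lemma arc_end_mem : Lam b.
Proof.
case: (gh) => -[_ _ _ _ <-] _ _; apply: arc_param_mem.
by rewrite in_itv/= lexx ler01.
Qed.

Lemma arc_coord_comp_continuous (f : R -> R[i]) :
  {within `[0, 1], continuous f} -> (forall t, t \in `[0, 1] -> Lam (f t)) ->
  {within `[0, 1], continuous (h \o f)}.
Proof.
move=> /within_continuous_itv_normcP cf fL; case: gh => _ ch _.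
apply/subspace_continuousP => t t01; apply/cvgrPdist_lt => e e0.
have [d d0 hd] := within_continuous_normcP ch (fL t t01) e0.
have [d' d'0 fd] := cf t t01 d d0.
rewrite near_withinE; exists d' => //= u tu u01.
apply: hd; [exact: fL|exact: fd].
Qed.

(** For another parametrization [g'], the map [h \o g'] is continuous and injective on [0, 1] and
    takes 0 to 0 and 1 to 1, hence is increasing. *)
Lemma arc_leP x y : arc_le a b Lam x y <-> [/\ Lam x, Lam y & h x <= h y].
Proof.
have i0 : 0 \in `[0, 1 : R] by rewrite in_itv/= lexx ler01.
have i1 : 1 \in `[0, 1 : R] by rewrite in_itv/= lexx ler01.
split=> [[g' [[g'L g'inj _] cg' _ g'0 g'1] [t [u [t0 [tu [u1 [-> ->]]]]]]]|[Lx Ly hxy]].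
  have t01 : t \in `[0, 1] by rewrite in_itv/= t0 (le_trans tu).
  have u01 : u \in `[0, 1] by rewrite in_itv/= u1 (le_trans t0).
  split; [exact: g'L|exact: g'L|].
  have inj : {in `[0, 1] &, injective (h \o g')}.
    move=> v w v01 w01 /= E.
    have /g'inj : g' v = g' w := arc_coord_inj (g'L _ v01) (g'L _ w01) E.
    by apply; apply/mem_set.
  have -> : (h (g' t) <= h (g' u)) = (t <= u).
    apply: (segment_continuous_inj_le (f := h \o g')) inj _ _ t01 u01.
      by rewrite /= g'0 g'1 arc_coord_start arc_coord_end ler01.
    by apply: arc_coord_comp_continuous => // v v01; exact: g'L.
  exact: tu.
have [hx gx] := arc_coordP Lx; have [hy gy] := arc_coordP Ly.
exists g; first by case: gh.
exists (h x), (h y); rewrite gx gy; move: hx hy; rewrite !in_itv/=.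
by move=> /andP[-> _] /andP[_ ->].
Qed.

End ArcCoordinate.

(** * Masses of the pieces and their order along the arc *)

Section ArcMeasure.
Variables (R : realType) (l : nat) (z : l.+1.-tuple R[i]) (q : nat).
Variables (Lam : set R[i]) (s : R) (g : R -> R[i]) (h : R[i] -> R).
Hypothesis z_0 : z`_0 = 0.
Hypothesis z_l : z`_l = 1.
Hypothesis Im_zq : 0 < complex.Im z`_q.
Hypothesis basic : basic_figure z q.
Hypothesis attr : attractor z Lam.
Hypothesis gh : arc_coord Lam 0 1 g h.
Hypothesis s_gt0 : 0 < s.
Hypothesis moran : \sum_(j < l) sim_ratio z j.+1 `^ s = 1.
Hypothesis H_gt0 : (0 < hausdorff_measure s Lam)%E.
Hypothesis H_lty : (hausdorff_measure s Lam < +oo)%E.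
Implicit Types (A B : set R[i]) (w v x y : R[i]) (j k n : nat).

Local Notation c := (z`_q).
Local Notation ratio j := (sim_ratio z j).

Definition arc_mass A : R := fine (hausdorff_measure s A).
(** This replaces the mass of the complement, to which it would be equal under additivity. *)
Definition arc_comass A : R := arc_mass Lam - arc_mass A.

Lemma arc_massE A : A `<=` Lam -> hausdorff_measure s A = (arc_mass A)%:E.
Proof.
move=> AL; rewrite /arc_mass fineK// ge0_fin_numE ?hausdorff_ge0//.
by apply: le_lt_trans H_lty; exact: hausdorff_mono.
Qed.

Lemma arc_mass_gt0 : 0 < arc_mass Lam.
Proof. by rewrite -lte_fin -arc_massE. Qed.

Lemma arc_mass0 : arc_mass set0 = 0.
Proof. by rewrite /arc_mass hausdorff_set0. Qed.

Lemma arc_mass_ge0 A : 0 <= arc_mass A.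
Proof. by rewrite /arc_mass fine_ge0 ?hausdorff_ge0. Qed.

Lemma arc_mass_mono A B : A `<=` B -> B `<=` Lam -> arc_mass A <= arc_mass B.
Proof.
move=> AB BL; rewrite -lee_fin -!arc_massE//; last exact: subset_trans BL.
exact: hausdorff_mono.
Qed.

Lemma arc_massU A B C : A `<=` B `|` C -> B `<=` Lam -> C `<=` Lam ->
  arc_mass A <= arc_mass B + arc_mass C.
Proof.
move=> AB BL CL; rewrite -lee_fin EFinD -!arc_massE//; last first.
  by move=> w /AB[/BL|/CL].
by apply: le_trans (hausdorffU _ _ _); exact: hausdorff_mono.
Qed.

Lemma arc_mass_sim j A : (1 <= j <= l)%N -> A `<=` Lam ->
  arc_mass (sim z j @` A) <= ratio j `^ s * arc_mass A.
Proof.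
move=> jl AL; rewrite -lee_fin EFinM -!arc_massE//; last first.
  by move=> _ [w /AL Lw <-]; exact: (attractor_stable attr).
apply: hausdorff_image; [exact: ltW|exact: (sim_ratio_gt0 basic)|].
by move=> w v; rewrite (sim_dist z_0).
Qed.

Lemma arc_mass_pieces A (B : nat -> set R[i]) : (forall j, B j `<=` Lam) ->
  (forall w, A w -> exists2 j, (1 <= j <= l)%N & (sim z j @` B j) w) ->
  arc_mass A <= \sum_(j < l) ratio j.+1 `^ s * arc_mass (B j.+1).
Proof.
move=> BL AB.
have SL (j : 'I_l) : sim z j.+1 @` B j.+1 `<=` Lam.
  by move=> _ [w /BL Lw <-]; apply: (attractor_stable attr) => //; exact: ltn_ord.
apply: (@le_trans _ _ (\sum_(j < l) arc_mass (sim z j.+1 @` B j.+1))); last first.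
  by apply: ler_sum => j _; apply: arc_mass_sim => //; exact: ltn_ord.
rewrite -lee_fin -sumEFin.
under eq_bigr => j _ do rewrite -(arc_massE (SL j)).
rewrite -arc_massE; last first.
  move=> w /AB[[|j]//= jl [v /BL Lv <-]].
  by apply: (attractor_stable attr).
apply: hausdorff_fin_cover => w /AB[[|j]//= jl Bw].
by exists (Ordinal jl).
Qed.

Lemma arc_comass_ge0 A : A `<=` Lam -> 0 <= arc_comass A.
Proof. by move=> AL; rewrite subr_ge0 arc_mass_mono. Qed.

(** The difference of the two sums has nonnegative terms, of which only the one of index [k] is
    kept. *)
Lemma arc_comass_step A (B : nat -> set R[i]) k : (forall j, B j `<=` Lam) ->
  (forall w, A w -> exists2 j, (1 <= j <= l)%N & (sim z j @` B j) w) ->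
  (1 <= k <= l)%N -> ratio k `^ s * arc_comass (B k) <= arc_comass A.
Proof.
case: k => [//|k] BL AB /= kl; have := arc_mass_pieces BL AB.
have : \sum_(j < l) ratio j.+1 `^ s * arc_mass Lam = arc_mass Lam.
  by rewrite -mulr_suml moran mul1r.
rewrite /arc_comass => {2}<- le_sum.
apply: (@le_trans _ _ (\sum_(j < l) ratio j.+1 `^ s * arc_mass Lam -
   \sum_(j < l) ratio j.+1 `^ s * arc_mass (B j.+1))); last by rewrite lerD2l lerN2.
rewrite -sumrB (bigD1 (Ordinal kl))//= -mulrBr lerDl sumr_ge0// => j _.
by rewrite -mulrBr mulr_ge0 ?powR_ge0// (arc_comass_ge0 (BL _)).
Qed.

(** Iterates of [S_l] shrink [Lam] towards 1 and those of [S_1] towards 0; followed by [S_p] and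
    [S_(p+1)], they give the cylinders that meet at [z_p]. *)
Definition lastN n w := iter n (sim z l) w.
Definition firstN n w := iter n (sim z 1) w.

Let ll : (1 <= l <= l)%N.
Proof. by rewrite (l_gt0 z_0 z_l Im_zq basic) leqnn. Qed.

Let l1 : (1 <= 1 <= l)%N.
Proof. exact: (l_gt0 z_0 z_l Im_zq basic). Qed.

Lemma lastN_stable n w : Lam w -> Lam (lastN n w).
Proof. by move=> Lw; elim: n => //= n; exact: (attractor_stable attr). Qed.

Lemma firstN_stable n w : Lam w -> Lam (firstN n w).
Proof. by move=> Lw; elim: n => //= n; exact: (attractor_stable attr). Qed.

Lemma lastNE n w : lastN n w - 1 = (ratio l ^+ n)%:C * (w - 1).
Proof.
elim: n => [|n IH]; first by rewrite expr0 rmorph1 mul1r.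
by rewrite /= (sim_last z_0 z_l basic) IH mulrA -rmorphM/= exprS.
Qed.

Lemma firstNE n w : firstN n w = (ratio 1 ^+ n)%:C * w.
Proof.
elim: n => [|n IH]; first by rewrite expr0 rmorph1 mul1r.
by rewrite /= (sim_first z_0 z_l basic) IH mulrA -rmorphM/= exprS.
Qed.

Lemma powRXn (r : R) n : 0 <= r -> (r ^+ n) `^ s = (r `^ s) ^+ n.
Proof.
move=> r0; elim: n => [|n IH]; first by rewrite !expr0 powR1.
by rewrite !exprS powRM ?exprn_ge0// IH.
Qed.

Let ratio_ge0 j : 0 <= ratio j. Proof. exact: normc_ge0. Qed.

Lemma arc_comass_lastN n :
  (ratio l ^+ n) `^ s * arc_mass Lam <= arc_comass (Lam `\` (lastN n @` Lam)).
Proof.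
rewrite powRXn//; elim: n => [|n IH].
  rewrite expr0 mul1r (_ : _ `\` _ = set0) /arc_comass ?arc_mass0 ?subr0//.
  by apply/seteqP; split => // w [Lw]; apply; exists w.
rewrite exprS -mulrA.
apply: (@le_trans _ _ (ratio l `^ s * arc_comass (Lam `\` (lastN n @` Lam)))).
  by rewrite ler_wpM2l ?powR_ge0.
pose B j := if (j == l)%N then Lam `\` (lastN n @` Lam) else Lam.
have -> : Lam `\` (lastN n @` Lam) = B l by rewrite /B eqxx.
apply: arc_comass_step => // [j|w [Lw nw]]; first by rewrite /B; case: ifP => _ v; [case|].
have [j [jl [v Lv vw]]] := attractor_cover attr Lw.
exists j => //; exists v => //; rewrite /B; case: eqP => // jE; split => //.
by move=> [u Lu uv]; apply: nw; exists u => //=; rewrite -vw -uv jE.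
Qed.

(** Otherwise the cylinder could be deleted from piece [j] without uncovering [Lam], although by
    [arc_comass_lastN] the deletion lowers the total below the mass of [Lam]. *)
Lemma no_overlap j k n : (1 <= j <= l)%N -> (1 <= k <= l)%N -> j != k ->
  ~ (forall w, Lam w -> (sim z k @` Lam) (sim z j (lastN n w))).
Proof.
move=> jl kl jk over.
pose B i := if (i == j)%N then Lam `\` (lastN n @` Lam) else Lam.
have : ratio j `^ s * arc_comass (B j) <= arc_comass Lam.
  apply: arc_comass_step => // [i|w Lw]; first by rewrite /B; case: ifP => _ v; [case|].
  have [i [il [v Lv vw]]] := attractor_cover attr Lw.
  have [iE|ij] := eqVneq i j; last first.
    by exists i => //; exists v => //; rewrite /B (negbTE ij).
  have [[u Lu uv]|nv] := pselect ((lastN n @` Lam) v); last first.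
    by exists i => //; exists v => //; rewrite /B iE eqxx.
  have [u' Lu' u'E] := over u Lu; exists k => //; exists u'.
    by rewrite /B eq_sym (negbTE jk).
  by rewrite u'E uv -iE.
rewrite {2}/arc_comass subrr /B eqxx leNgt => /negP; apply.
apply: mulr_gt0; first by rewrite powR_gt0// (sim_ratio_gt0 basic).
apply: lt_le_trans (arc_comass_lastN n).
by rewrite mulr_gt0 ?arc_mass_gt0// powR_gt0// exprn_gt0// (sim_ratio_gt0 basic).
Qed.

Lemma Lam0 : Lam 0. Proof. exact: arc_start_mem gh. Qed.
Lemma Lam1 : Lam 1. Proof. exact: arc_end_mem gh. Qed.

Lemma coord_bounds w : Lam w -> 0 <= h w <= 1.
Proof. by move=> /(arc_coordP gh)[]; rewrite in_itv. Qed.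

Lemma vertex_mem j : (j <= l)%N -> Lam z`_j.
Proof.
case: j => [_|j jl]; first by rewrite z_0; exact: Lam0.
by rewrite -(sim_at1 z_0 z_l); apply: (attractor_stable attr) => //; exact: Lam1.
Qed.

Let psi j := h \o (sim z j \o g).

Let psi_continuous j : (1 <= j <= l)%N -> {within `[0, 1], continuous (psi j)}.
Proof.
move=> jl; apply: (arc_coord_comp_continuous gh); last first.
  by move=> t /(arc_param_mem gh); exact: (attractor_stable attr).
apply/within_continuous_itv_normcP => t t01 e e0.
have rj := sim_ratio_gt0 basic jl.
have cg : {within `[0, 1], continuous g} by case: gh => -[].
have [|d d0 gd] := (within_continuous_itv_normcP _ _ _).1 cg t t01 (e / ratio j).
  by rewrite divr_gt0.
exists d => // u u01 /(gd _ u01); rewrite /= (sim_dist z_0).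
by rewrite ltr_pdivlMr// mulrC.
Qed.

Let psi_inj j : (1 <= j <= l)%N -> {in `[0, 1] &, injective (psi j)}.
Proof.
move=> jl t u t01 u01 /= E.
have Lt := arc_param_mem gh t01; have Lu := arc_param_mem gh u01.
have := arc_coord_inj gh (attractor_stable attr jl Lt) (attractor_stable attr jl Lu) E.
move/(sim_inj z_0 basic jl)/(congr1 h).
by rewrite !(arc_paramK gh).
Qed.

Let psi0 j : psi j 0 = h z`_j.-1.
Proof. by case: gh => -[_ _ _ g0 _] _ _; rewrite /psi /= g0 (sim_at0 z_0). Qed.

Let psi1 j : psi j 1 = h z`_j.
Proof. by case: gh => -[_ _ _ _ g1] _ _; rewrite /psi /= g1 (sim_at1 z_0 z_l). Qed.

Let psiE j w : Lam w -> psi j (h w) = h (sim z j w).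
Proof. by move=> /(arc_coordP gh)[_ gw]; rewrite /psi /= gw. Qed.

(** The orientation of the end points is a hypothesis because the induction of [vertex_coord_lt],
    which establishes it, relies on this lemma. *)
Lemma sim_coord_mono j x y : (1 <= j <= l)%N -> h z`_j.-1 <= h z`_j ->
  Lam x -> Lam y -> (h (sim z j x) <= h (sim z j y)) = (h x <= h y).
Proof.
move=> jl jj Lx Ly; rewrite -!psiE//.
have [hx _] := arc_coordP gh Lx; have [hy _] := arc_coordP gh Ly.
apply: (segment_continuous_inj_le (f := psi j)) _ _ _ hx hy.
- by rewrite psi0 psi1.
- exact: psi_continuous.
- exact: psi_inj.
Qed.

(** The intermediate value theorem applies whichever way the piece runs, hence [Num.min] and
    [Num.max]. *)
Lemma coord_between j w : (1 <= j <= l)%N -> Lam w ->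
  Num.min (h z`_j.-1) (h z`_j) <= h w <= Num.max (h z`_j.-1) (h z`_j) ->
  (sim z j @` Lam) w.
Proof.
move=> jl Lw hw.
have [|t t01 tw] := IVT ler01 (psi_continuous jl) (v := h w).
  by rewrite psi0 psi1.
have Lt := arc_param_mem gh t01.
exists (g t) => //; apply: (arc_coord_inj gh) => //.
exact: (attractor_stable attr).
Qed.

Lemma vertex_coord_neq j : (1 <= j <= l)%N -> h z`_j.-1 != h z`_j.
Proof.
move=> jl; apply/eqP => /(arc_coord_inj gh) E.
have := sim_coef_neq0 basic jl; rewrite (sim_coefE z_0 z_l) E ?subrr ?eqxx//.
- by apply: vertex_mem; case/andP: jl => _; exact: leq_trans (leq_pred _).
- by apply: vertex_mem; case/andP: jl.
Qed.

Lemma lastN_near w (e : R) : 0 < e -> exists n, forall v, Lam v ->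
  modulus (1 - lastN n v) < e.
Proof.
move=> e0; have [_ cL _] := attr; have [B B0 LB] := compact_normc_bounded cL.
have /andP[r0 r1] := sim_contractive basic ll.
have [N HN] : exists N, forall n, (N <= n)%N -> ratio l ^+ n < e / (B + 1).
  by apply: expr_small; rewrite ?(ltW r0)// divr_gt0// addr_gt0.
exists N => v Lv; rewrite normc_distC lastNE normcM normc_real ger0_norm ?exprn_ge0//.
have vB : modulus (v - 1) <= B + 1.
  by apply: le_trans (normcD _ _) _; rewrite normcN normc1 lerD2r LB.
have := HN N (leqnn _); rewrite ltr_pdivlMr ?addr_gt0//; apply: le_lt_trans.
by rewrite ler_wpM2l ?exprn_ge0.
Qed.

(* If the arc turned back at z_j, a small cylinder of S_j(Lam) near z_j would
   lie inside S_(j+1)(Lam), against Moran's equation. *)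
Lemma vertex_coord_lt j : (1 <= j <= l)%N -> h z`_j.-1 < h z`_j.
Proof.
elim: j => [//|j IH] jl; rewrite lt_neqAle vertex_coord_neq//=.
case: j IH jl => [|j] IH jl.
  rewrite /= z_0 (arc_coord_start gh).
  by have /andP[] := coord_bounds (vertex_mem (j := 1) l1).
have jl' : (1 <= j.+1 <= l)%N by case/andP: jl => _ /ltnW ->.
have {IH} lt1 := IH jl'; rewrite /= in lt1 *; rewrite leNgt; apply/negP => lt2.
have Lz : Lam z`_j.+1 by apply: vertex_mem; case/andP: jl'.
pose e := Num.min (h z`_j.+1 - h z`_j) (h z`_j.+1 - h z`_j.+2).
have e0 : 0 < e by rewrite lt_min !subr_gt0 lt1.
have [_ ch _] := gh.
have [d d0 hd] := within_continuous_normcP ch Lz e0.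
have rj := sim_ratio_gt0 basic jl'.
have [|n Hn] := lastN_near 0 (e := d / ratio j.+1); first by rewrite divr_gt0.
apply: (@no_overlap j.+1 j.+2 n) => //; first by rewrite neq_ltn ltnSn.
move=> w Lw; have Lnw := lastN_stable n Lw.
have LSw := attractor_stable attr jl' Lnw.
apply: coord_between => //=.
have : `|h z`_j.+1 - h (sim z j.+1 (lastN n w))| < e.
  apply: hd => //; rewrite -(sim_at1 z_0 z_l j.+1) (sim_dist z_0).
  by rewrite mulrC -ltr_pdivlMr// Hn.
rewrite ltr_norml lt_min => /andP[_ /andP[lo1 lo2]].
rewrite ge_min le_max; apply/andP; split.
  by apply/orP; right; lra.
apply/orP; left.
rewrite -(sim_at1 z_0 z_l j.+1) sim_coord_mono ?(ltW lt1)//; last exact: Lam1.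
by rewrite (arc_coord_end gh); case/andP: (coord_bounds Lnw).
Qed.

Lemma sim_mono j x y : (1 <= j <= l)%N -> Lam x -> Lam y ->
  (h (sim z j x) <= h (sim z j y)) = (h x <= h y).
Proof.
move=> jl; apply: sim_coord_mono => //; exact/ltW/vertex_coord_lt.
Qed.

Lemma sim_coord_bounds j x : (1 <= j <= l)%N -> Lam x ->
  h z`_j.-1 <= h (sim z j x) <= h z`_j.
Proof.
move=> jl Lx; rewrite -(sim_at0 z_0) -(sim_at1 z_0 z_l).
rewrite !sim_mono ?(arc_coord_start gh) ?(arc_coord_end gh) ?coord_bounds//.
- exact: Lam1.
- exact: Lam0.
Qed.

Lemma coord_in_piece j w : (1 <= j <= l)%N -> Lam w ->
  h z`_j.-1 <= h w <= h z`_j -> (sim z j @` Lam) w.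
Proof.
move=> jl Lw hw; apply: coord_between => //.
have /ltW jj := vertex_coord_lt jl.
by rewrite (min_idPl jj) (max_idPr jj).
Qed.

Lemma vertex_coord_mono j k : (j <= k)%N -> (k <= l)%N -> h z`_j <= h z`_k.
Proof.
move=> + kl; elim: k kl => [|k IH] kl; first by rewrite leqn0 => /eqP->.
rewrite leq_eqVlt => /orP[/eqP->//|]; rewrite ltnS => /(IH (ltnW kl)) /le_trans.
by apply; exact/ltW/(@vertex_coord_lt k.+1).
Qed.

Lemma sim_coord_lt_index j k x y : (1 <= j)%N -> (j < k)%N -> (k <= l)%N ->
  Lam x -> Lam y -> h (sim z j x) <= h (sim z k y).
Proof.
move=> j1 jk kl Lx Ly.
have jl : (1 <= j <= l)%N by rewrite j1 (leq_trans (ltnW jk)).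
have kl' : (1 <= k <= l)%N by rewrite (leq_trans j1 (ltnW jk)).
have /andP[_ h1] := sim_coord_bounds jl Lx.
have /andP[h2 _] := sim_coord_bounds kl' Ly.
apply: le_trans h1 (le_trans _ h2); apply: vertex_coord_mono.
  by rewrite -ltnS (ltn_predK jk).
exact: leq_trans (leq_pred _) kl.
Qed.

(** * Masses of initial and final subarcs *)

Definition below x : set R[i] := [set w | Lam w /\ h w <= h x].
Definition above x : set R[i] := [set w | Lam w /\ h x <= h w].

Lemma below_sub x : below x `<=` Lam. Proof. by move=> w []. Qed.
Lemma above_sub x : above x `<=` Lam. Proof. by move=> w []. Qed.

Lemma subarc_below x : Lam x -> subarc 0 1 Lam 0 x = below x.
Proof.
move=> Lx; apply/seteqP; split => w.
  by move=> [_ /(arc_leP gh)[Lw _ wx]].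
move=> [Lw wx]; split; apply/(arc_leP gh); split => //; first exact: Lam0.
by rewrite (arc_coord_start gh); case/andP: (coord_bounds Lw).
Qed.

(** The part of [Lam] whose image under [S_j] is needed to cover [below (sim z p x)]. *)
Definition below_pieces p x j :=
  if (j < p)%N then Lam else if (j == p)%N then below x else set0.
Definition above_pieces p x j :=
  if (p < j)%N then Lam else if (j == p)%N then above x else set0.

Lemma below_pieces_sub p x j : below_pieces p x j `<=` Lam.
Proof.
rewrite /below_pieces; case: ifP => _; first by [].
by case: ifP => _; [exact: below_sub|exact: sub0set].
Qed.

Lemma above_pieces_sub p x j : above_pieces p x j `<=` Lam.
Proof.
rewrite /above_pieces; case: ifP => _; first by [].
by case: ifP => _; [exact: above_sub|exact: sub0set].
Qed.

Lemma below_pieces_cover p x w : (1 <= p <= l)%N -> Lam x -> below (sim z p x) w ->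
  exists2 j, (1 <= j <= l)%N & (sim z j @` below_pieces p x j) w.
Proof.
move=> pl Lx [Lw wx]; have [j [jl [v Lv vw]]] := attractor_cover attr Lw.
have [jp|pj|jp] := ltngtP j p.
- by exists j => //; exists v => //; rewrite /below_pieces jp.
(* A later piece meets [below (sim z p x)] at most in [sim z p x] itself, which piece [p] covers. *)
- exists p => //; exists x; last first.
    apply: (arc_coord_inj gh) => //; first exact: (attractor_stable attr).
    apply/eqP; rewrite eq_le wx andbT -vw.
    by apply: sim_coord_lt_index => //; [case/andP: pl|case/andP: jl].
  by rewrite /below_pieces ltnn eqxx; split.
- exists j => //; exists v => //; rewrite /below_pieces jp ltnn eqxx.
  by split => //; rewrite -(sim_mono pl)// -jp vw jp.
Qed.

Lemma above_pieces_cover p x w : (1 <= p <= l)%N -> Lam x -> above (sim z p x) w ->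
  exists2 j, (1 <= j <= l)%N & (sim z j @` above_pieces p x j) w.
Proof.
move=> pl Lx [Lw wx]; have [j [jl [v Lv vw]]] := attractor_cover attr Lw.
have [jp|pj|jp] := ltngtP j p.
- exists p => //; exists x; last first.
    apply: (arc_coord_inj gh) => //; first exact: (attractor_stable attr).
    apply/eqP; rewrite eq_le wx /= -vw.
    by apply: sim_coord_lt_index => //; [case/andP: jl|case/andP: pl].
  by rewrite /above_pieces ltnn eqxx; split.
- by exists j => //; exists v => //; rewrite /above_pieces pj.
- exists j => //; exists v => //; rewrite /above_pieces jp ltnn eqxx.
  by split => //; rewrite -(sim_mono pl)// -jp vw jp.
Qed.

Lemma arc_comass_below p x : (1 <= p <= l)%N -> Lam x ->
  ratio p `^ s * arc_comass (below x) <= arc_comass (below (sim z p x)).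
Proof.
move=> pl Lx; have -> : below x = below_pieces p x p.
  by rewrite /below_pieces ltnn eqxx.
apply: arc_comass_step => //; first exact: below_pieces_sub.
by move=> w; exact: below_pieces_cover.
Qed.

Lemma arc_comass_above p x : (1 <= p <= l)%N -> Lam x ->
  ratio p `^ s * arc_comass (above x) <= arc_comass (above (sim z p x)).
Proof.
move=> pl Lx; have -> : above x = above_pieces p x p.
  by rewrite /above_pieces ltnn eqxx.
apply: arc_comass_step => //; first exact: above_pieces_sub.
by move=> w; exact: above_pieces_cover.
Qed.

Lemma apex_mem : Lam c.
Proof.
apply: vertex_mem; have := apex_index_bounds z_0 z_l Im_zq basic.
by move=> /andP[_ /ltnW/ltnW].
Qed.

Lemma arc_comass_below_lastN n : (ratio l ^+ n) `^ s * arc_comass (below c) <=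
  arc_comass (below (lastN n c)).
Proof.
rewrite powRXn//; elim: n => [|n IH]; first by rewrite mul1r.
rewrite exprS -mulrA; apply: le_trans (arc_comass_below ll (lastN_stable n apex_mem)).
by rewrite ler_wpM2l ?powR_ge0.
Qed.

Lemma arc_comass_above_firstN n : (ratio 1 ^+ n) `^ s * arc_comass (above c) <=
  arc_comass (above (firstN n c)).
Proof.
rewrite powRXn//; elim: n => [|n IH]; first by rewrite mul1r.
rewrite exprS -mulrA; apply: le_trans (arc_comass_above l1 (firstN_stable n apex_mem)).
by rewrite ler_wpM2l ?powR_ge0.
Qed.

(** Since the apex is [S_q] of 1, covering [below c] needs nothing from piece [q.+1], whose whole
    mass is therefore missing. *)
Lemma arc_comass_below_apex : 0 < arc_comass (below c).
Proof.
have /andP[q1 q2] := apex_index_bounds z_0 z_l Im_zq basic.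
have ql : (1 <= q <= l)%N by lia.
have q1l : (1 <= q.+1 <= l)%N by lia.
have pq : below_pieces q 1 q.+1 = set0.
  by rewrite /below_pieces ltnNge leqnSn /= gtn_eqF.
have step := @arc_comass_step (below c) (below_pieces q 1) q.+1.
rewrite pq {1}/arc_comass arc_mass0 subr0 in step.
apply: lt_le_trans (step _ _ q1l).
- by rewrite mulr_gt0 ?arc_mass_gt0// powR_gt0// (sim_ratio_gt0 basic).
- exact: below_pieces_sub.
- move=> w; rewrite -{1}(sim_at1 z_0 z_l q); apply: below_pieces_cover => //.
  exact: Lam1.
Qed.

Lemma arc_comass_above_apex : 0 < arc_comass (above c).
Proof.
have /andP[q1 q2] := apex_index_bounds z_0 z_l Im_zq basic.
have ql : (1 <= q <= l)%N by lia.
have q1l : (1 <= q.+1 <= l)%N by lia.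
have pq : above_pieces q.+1 0 q = set0.
  by rewrite /above_pieces ltnNge leqnSn /= ltn_eqF.
have step := @arc_comass_step (above c) (above_pieces q.+1 0) q.
rewrite pq {1}/arc_comass arc_mass0 subr0 in step.
apply: lt_le_trans (step _ _ ql).
- by rewrite mulr_gt0 ?arc_mass_gt0// powR_gt0// (sim_ratio_gt0 basic).
- exact: above_pieces_sub.
- move=> w; rewrite -{1}(sim_at0 z_0 q.+1); apply: above_pieces_cover => //.
  exact: Lam0.
Qed.

(** A lower bound for a difference of masses: [below] and [above] the second point share out at
    least the full mass, and the covers bound from above both this [above] and the [below] of the
    first point. *)
Lemma arc_mass_gap p x y : (1 <= p)%N -> (p < l)%N -> Lam x -> Lam y ->
  ratio p `^ s * arc_comass (below x) <=
    arc_mass (below (sim z p.+1 y)) - arc_mass (below (sim z p x)) /\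
  ratio p.+1 `^ s * arc_comass (above y) <=
    arc_mass (below (sim z p.+1 y)) - arc_mass (below (sim z p x)).
Proof.
move=> p1 pl Lx Ly.
have pl' : (1 <= p <= l)%N by rewrite p1 ltnW.
have pl1 : (1 <= p.+1 <= l)%N by [].
have total : arc_mass Lam <= arc_mass (below (sim z p.+1 y)) +
    arc_mass (above (sim z p.+1 y)).
  apply: arc_massU; [|exact: below_sub|exact: above_sub].
  by move=> w Lw; have [?|/ltW?] := leP (h w) (h (sim z p.+1 y)); [left|right].
have b := arc_mass_pieces (@below_pieces_sub p x)
  (fun w => @below_pieces_cover p x w pl' Lx).
have a := arc_mass_pieces (@above_pieces_sub p.+1 y)
  (fun w => @above_pieces_cover p.+1 y w pl1 Ly).
pose d (j : 'I_l) := arc_mass Lam - arc_mass (below_pieces p x j.+1) -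
  arc_mass (above_pieces p.+1 y j.+1).
(* No index has both a nonempty [below_pieces] and a nonempty [above_pieces], so a full mass is
   never exceeded. *)
have d0 (j : 'I_l) : 0 <= d j.
  have M0 := arc_mass_ge0.
  have bj := arc_comass_ge0 (@below_pieces_sub p x j.+1).
  have aj := arc_comass_ge0 (@above_pieces_sub p.+1 y j.+1).
  move: bj aj; rewrite /d /arc_comass /below_pieces /above_pieces.
  case: (ltngtP j.+1 p) => jp.
  - have -> : (p.+1 < j.+1)%N = false by lia.
    have -> : (j.+1 == p.+1) = false by lia.
    rewrite arc_mass0; lra.
  - by case: ifP => _; [|case: ifP => _]; rewrite ?arc_mass0; lra.
  - have -> : (p.+1 < j.+1)%N = false by lia.
    have -> : (j.+1 == p.+1) = false by lia.
    rewrite arc_mass0; lra.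
have dsum : \sum_(j < l) ratio j.+1 `^ s * d j <=
    arc_mass (below (sim z p.+1 y)) - arc_mass (below (sim z p x)).
  have -> : \sum_(j < l) ratio j.+1 `^ s * d j = arc_mass Lam -
      \sum_(j < l) ratio j.+1 `^ s * arc_mass (below_pieces p x j.+1) -
      \sum_(j < l) ratio j.+1 `^ s * arc_mass (above_pieces p.+1 y j.+1).
    rewrite -[X in _ = X - _ - _]mul1r -moran mulr_suml -!sumrB.
    by apply: eq_bigr => j _; rewrite /d; ring.
  lra.
have single (j : 'I_l) : ratio j.+1 `^ s * d j <= \sum_(j < l) ratio j.+1 `^ s * d j.
  rewrite [leRHS](bigD1 j)//= lerDl sumr_ge0// => k _.
  by rewrite mulr_ge0 ?powR_ge0.
have pl2 : (p.-1 < l)%N by exact: leq_ltn_trans (leq_pred _) pl.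
split; apply: le_trans dsum.
- apply: le_trans (single (Ordinal pl2)); rewrite /d /= (prednK p1).
  rewrite /below_pieces /above_pieces ltnn eqxx.
  have -> : (p.+1 < p)%N = false by lia.
  have -> : (p == p.+1) = false by lia.
  by rewrite arc_mass0 subr0.
- apply: le_trans (single (Ordinal pl)); rewrite /d /=.
  rewrite /below_pieces /above_pieces ltnn eqxx.
  have -> : (p.+1 < p)%N = false by lia.
  have -> : (p.+1 == p) = false by lia.
  by rewrite arc_mass0 subr0.
Qed.

Lemma coord_in_lastN n x w : Lam x -> Lam w -> h (lastN n x) <= h w ->
  (lastN n @` Lam) w.
Proof.
move=> Lx; elim: n w => [|n IH] w Lw xw; first by exists w.
have Ln := lastN_stable n Lx.
have [|v Lv vw] := coord_in_piece ll Lw.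
  rewrite z_l (arc_coord_end gh) andbC; case/andP: (coord_bounds Lw) => _ -> /=.
  by apply: le_trans xw; case/andP: (sim_coord_bounds ll Ln).
have [|u Lu uv] := IH v Lv; first by rewrite -(sim_mono ll)// vw.
by exists u => //=; rewrite -vw -uv.
Qed.

Lemma coord_in_firstN n x w : Lam x -> Lam w -> h w <= h (firstN n x) ->
  (firstN n @` Lam) w.
Proof.
move=> Lx; elim: n w => [|n IH] w Lw xw; first by exists w.
have Ln := firstN_stable n Lx.
have [|v Lv vw] := coord_in_piece l1 Lw.
  rewrite /= z_0 (arc_coord_start gh); case/andP: (coord_bounds Lw) => -> _ /=.
  by apply: le_trans xw _; case/andP: (sim_coord_bounds l1 Ln).
have [|u Lu uv] := IH v Lv; first by rewrite -(sim_mono l1)// vw.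
by exists u => //=; rewrite -vw -uv.
Qed.

Lemma arc_mass_lastN n : arc_mass (lastN n @` Lam) <= (ratio l ^+ n) `^ s * arc_mass Lam.
Proof.
rewrite powRXn//; elim: n => [|n IH].
  by rewrite mul1r arc_mass_mono// => _ [w Lw <-].
have -> : lastN n.+1 @` Lam = sim z l @` (lastN n @` Lam) by rewrite image_comp.
apply: le_trans (arc_mass_sim ll _) _.
  by move=> _ [w Lw <-]; exact: lastN_stable.
by rewrite exprS -mulrA ler_wpM2l ?powR_ge0.
Qed.

Lemma arc_mass_firstN n : arc_mass (firstN n @` Lam) <= (ratio 1 ^+ n) `^ s * arc_mass Lam.
Proof.
rewrite powRXn//; elim: n => [|n IH].
  by rewrite mul1r arc_mass_mono// => _ [w Lw <-].
have -> : firstN n.+1 @` Lam = sim z 1 @` (firstN n @` Lam) by rewrite image_comp.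
apply: le_trans (arc_mass_sim l1 _) _.
  by move=> _ [w Lw <-]; exact: firstN_stable.
by rewrite exprS -mulrA ler_wpM2l ?powR_ge0.
Qed.

(** Each point of the arc between the two lies in one of the two cylinders that meet at [z_p]. The
    factors from [S_p] and [S_(p+1)] are at most 1 and are dropped. *)
Lemma arc_mass_gap_le p n k x y : (1 <= p)%N -> (p < l)%N -> Lam x -> Lam y ->
  `|arc_mass (below (sim z p (lastN n x))) -
    arc_mass (below (sim z p.+1 (firstN k y)))| <=
  ((ratio l ^+ n) `^ s + (ratio 1 ^+ k) `^ s) * arc_mass Lam.
Proof.
move=> p1 pl Lx Ly.
have pl' : (1 <= p <= l)%N by rewrite p1 ltnW.
have pl1 : (1 <= p.+1 <= l)%N by [].
have Ln := lastN_stable n Lx; have Lk := firstN_stable k Ly.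
have piece1 A j : (1 <= j <= l)%N -> A `<=` Lam -> arc_mass (sim z j @` A) <= arc_mass A.
  move=> jl AL; apply: le_trans (arc_mass_sim jl AL) _.
  rewrite ler_piMl ?arc_mass_ge0//.
  case/andP: (sim_contractive basic jl) => r0 r1.
  have -> : 1 = 1 `^ s :> R by rewrite powR1.
  by rewrite ge0_ler_powR ?nnegrE// ltW.
have sub1 : lastN n @` Lam `<=` Lam by move=> _ [w Lw <-]; exact: lastN_stable.
have sub2 : firstN k @` Lam `<=` Lam by move=> _ [w Lw <-]; exact: firstN_stable.
have Ssub j A : (1 <= j <= l)%N -> A `<=` Lam -> sim z j @` A `<=` Lam.
  by move=> jl AL _ [w /AL Lw <-]; exact: (attractor_stable attr).
have le_xy : h (sim z p (lastN n x)) <= h (sim z p.+1 (firstN k y)).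
  exact: sim_coord_lt_index.
have lower : arc_mass (below (sim z p (lastN n x))) <=
    arc_mass (below (sim z p.+1 (firstN k y))).
  apply: arc_mass_mono; last exact: below_sub.
  by move=> w [Lw wx]; split => //; exact: le_trans le_xy.
have upper : arc_mass (below (sim z p.+1 (firstN k y))) <=
    arc_mass (below (sim z p (lastN n x))) +
    arc_mass (sim z p @` (lastN n @` Lam) `|` sim z p.+1 @` (firstN k @` Lam)).
  apply: arc_massU; [|exact: below_sub|by move=> w []; exact: Ssub].
  move=> w [Lw wy]; have [wx|/ltW xw] := leP (h w) (h (sim z p (lastN n x))).
    by left.
  right; have [wp|/ltW pw] := leP (h w) (h z`_p).
    have [|v Lv vw] := coord_in_piece pl' Lw.
      by rewrite wp andbT (le_trans _ xw)//; case/andP: (sim_coord_bounds pl' Ln).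
    left; exists v => //; apply: (coord_in_lastN Lx) => //.
    by rewrite -(sim_mono pl')// vw.
  have [|v Lv vw] := coord_in_piece pl1 Lw.
    by rewrite pw (le_trans wy)//; case/andP: (sim_coord_bounds pl1 Lk).
  right; exists v => //; apply: (coord_in_firstN Ly) => //.
  by rewrite -(sim_mono pl1)// vw.
rewrite distrC ger0_norm ?subr_ge0// lerBlDl; apply: le_trans upper _.
rewrite lerD2l; apply: (@le_trans _ _ (arc_mass (sim z p @` (lastN n @` Lam)) +
   arc_mass (sim z p.+1 @` (firstN k @` Lam)))).
  by apply: arc_massU => //; exact: Ssub.
rewrite mulrDl; apply: lerD.
  by apply: le_trans (piece1 _ _ pl' sub1) (arc_mass_lastN n).
by apply: le_trans (piece1 _ _ pl1 sub2) (arc_mass_firstN k).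
Qed.

End ArcMeasure.

(** * Contact at a vertex with corner angle 0 *)

Section ContactAngle.
Variables (R : realType) (l : nat) (z : l.+1.-tuple R[i]) (q p : nat).
Variables (Lam : set R[i]) (s : R) (g : R -> R[i]) (h : R[i] -> R).
Hypothesis z_0 : z`_0 = 0.
Hypothesis z_l : z`_l = 1.
Hypothesis Im_zq : 0 < complex.Im z`_q.
Hypothesis basic : basic_figure z q.
Hypothesis attr : attractor z Lam.
Hypothesis gh : arc_coord Lam 0 1 g h.
Hypothesis s_gt0 : 0 < s.
Hypothesis moran : \sum_(j < l) sim_ratio z j.+1 `^ s = 1.
Hypothesis H_gt0 : (0 < hausdorff_measure s Lam)%E.
Hypothesis H_lty : (hausdorff_measure s Lam < +oo)%E.
Hypothesis p_gt0 : (1 <= p)%N.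
Hypothesis p_ltl : (p < l)%N.
Hypothesis corner0 : corner_angle z q p = 0.
Hypothesis char_gt0 : 0 < characteristic_angle z q.
Implicit Types (w v x y : R[i]) (n k : nat).

Local Notation c := (z`_q).
Local Notation ratio j := (sim_ratio z j).
Local Notation lam := (ratio l).
Local Notation mu := (ratio 1).
Local Notation alpha := (ratio p * modulus (1 - c)).
Local Notation beta := (ratio p.+1 * modulus c).
Local Notation lastN := (lastN z).
Local Notation firstN := (firstN z).
Local Notation mass := (arc_mass s).
Local Notation below := (below Lam h).

Let pl : (1 <= p <= l)%N. Proof. by rewrite p_gt0 ltnW. Qed.
Let pl1 : (1 <= p.+1 <= l)%N. Proof. exact: p_ltl. Qed.
Let ll : (1 <= l <= l)%N.
Proof. by rewrite (l_gt0 z_0 z_l Im_zq basic) leqnn. Qed.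
Let l1 : (1 <= 1 <= l)%N.
Proof. exact: (l_gt0 z_0 z_l Im_zq basic). Qed.

Let c_neq0 : c != 0.
Proof. by apply: contraTneq Im_zq => ->; rewrite ltxx. Qed.

Let c_neq1 : 1 - c != 0.
Proof. by rewrite subr_eq0 eq_sym; apply: contraTneq Im_zq => ->; rewrite ltxx. Qed.

Let c_subr1 : c - 1 != 0. Proof. by rewrite -oppr_eq0 opprB. Qed.
Let Nc0 : 0 < modulus c. Proof. by rewrite normc_gt0. Qed.
Let Nc1 : 0 < modulus (1 - c). Proof. by rewrite normc_gt0. Qed.
Let rp0 : 0 < ratio p. Proof. exact: (sim_ratio_gt0 basic). Qed.
Let rp10 : 0 < ratio p.+1. Proof. exact: (sim_ratio_gt0 basic). Qed.
Let lam0 : 0 < lam. Proof. exact: (sim_ratio_gt0 basic). Qed.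
Let mu0 : 0 < mu. Proof. exact: (sim_ratio_gt0 basic). Qed.
Let beta0 : 0 < beta. Proof. by rewrite mulr_gt0. Qed.

Lemma eta_gt0 : 0 < eta1 z q /\ 0 < eta2 z q.
Proof.
have theta0 : theta_min z q <= 0.
  rewrite -corner0 /theta_min; apply: bigmin_inf_seq (lexx _) => //.
  by rewrite mem_index_iota p_gt0.
suff : 0 < eta0 z q by rewrite /eta0 lt_min => /andP.
by move: char_gt0; rewrite /characteristic_angle; lra.
Qed.

(** A zero corner angle makes the quotient of the two vectors a positive real, and their moduli are
    the two coefficients. *)
Lemma common_direction : exists e : R[i], [/\ modulus e = 1,
  sim_coef z p * (c - 1) = alpha%:C * e & sim_coef z p.+1 * c = beta%:C * e].
Proof.
have a_p := sim_coef_neq0 basic pl; have a_p1 := sim_coef_neq0 basic pl1.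
have dp : sim z p c - z`_p = sim_coef z p * (c - 1).
  by rewrite -[z`_p](sim_at1 z_0 z_l) (sim_sub z_0).
have dp1 : sim z p.+1 c - z`_p = sim_coef z p.+1 * c.
  by rewrite -[z`_p](sim_at0 z_0 p.+1) (sim_sub z_0) subr0.
have [||t t0 tE] := @arg_eq0 R ((sim z p c - z`_p) / (sim z p.+1 c - z`_p)).
- by rewrite dp dp1; apply: mulf_neq0; rewrite ?invr_eq0; apply: mulf_neq0.
- exact: corner0.
have a1c : sim_coef z p.+1 * c != 0 by rewrite mulf_neq0.
have E : sim_coef z p * (c - 1) = t%:C * (sim_coef z p.+1 * c).
  by rewrite -dp -dp1 -tE divfK// dp1.
have n1 : modulus (sim_coef z p * (c - 1)) = alpha by rewrite normcM normc_distC.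
have n2 : modulus (sim_coef z p.+1 * c) = beta by exact: normcM.
have tab : alpha = t * beta by rewrite -n1 E normcM normc_real gtr0_norm// n2.
have bC : beta%:C != 0 :> R[i] by rewrite eq_complex /= eqxx andbT gt_eqF.
exists (sim_coef z p.+1 * c / beta%:C); split.
- by rewrite normcM normcV n2 normc_real gtr0_norm// divff// gt_eqF.
- rewrite E tab [(t * _)%:C]rmorphM -[RHS]mulrA; congr (_ * _).
  by rewrite [RHS]mulrC divfK.
- by rewrite [RHS]mulrC divfK.
Qed.

Lemma sim_lastN n w : sim z p (lastN n w) - z`_p =
  sim_coef z p * (lam ^+ n)%:C * (w - 1).
Proof.
rewrite -[z`_p](sim_at1 z_0 z_l) (sim_sub z_0).
by rewrite (lastNE z_0 z_l basic) mulrA.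
Qed.

Lemma sim_firstN n w : sim z p.+1 (firstN n w) - z`_p =
  sim_coef z p.+1 * (mu ^+ n)%:C * w.
Proof.
rewrite -[z`_p](sim_at0 z_0 p.+1) (sim_sub z_0) subr0.
by rewrite (firstNE z_0 z_l basic) mulrA.
Qed.

Lemma apex_dist n k :
  modulus (sim z p (lastN n c) - sim z p.+1 (firstN k c)) =
  `|alpha * lam ^+ n - beta * mu ^+ k|.
Proof.
have [e [e1 E0 E1]] := common_direction.
have -> : sim z p (lastN n c) - sim z p.+1 (firstN k c) =
    (alpha * lam ^+ n - beta * mu ^+ k)%:C * e.
  have -> : sim z p (lastN n c) - sim z p.+1 (firstN k c) =
    (sim z p (lastN n c) - z`_p) - (sim z p.+1 (firstN k c) - z`_p) by ring.
  rewrite sim_lastN sim_firstN ![_ * _%:C * _]mulrAC E0 E1.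
  by rewrite rmorphB !rmorphM/=; ring.
by rewrite normcM normc_real e1 mulr1.
Qed.

Lemma Im_div w v : complex.Im (w / v) =
  (complex.Im w * complex.Re v - complex.Re w * complex.Im v) / modulus v ^+ 2.
Proof.
case: w v => a b [a' b'] /=; rewrite sqr_sqrtr ?addr_ge0 ?sqr_ge0//.
by ring.
Qed.

(* On the two sides of the common direction the imaginary parts have opposite
   signs, so neither can exceed the distance. *)
Lemma transversal_dist n k w v :
  ratio p * lam ^+ n * side1 c w / modulus (1 - c) +
  ratio p.+1 * mu ^+ k * side0 c v / modulus c <=
  modulus (sim z p (lastN n w) - sim z p.+1 (firstN k v)).
Proof.
have [e [e1 E0 E1]] := common_direction.
have e0 : e != 0 by rewrite -normc_eq0 e1 oner_eq0.
have c1 : c - 1 != 0 by rewrite -oppr_eq0 opprB.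
have Ex : (sim z p (lastN n w) - z`_p) / e = (alpha * lam ^+ n)%:C * ((w - 1) / (c - 1)).
  apply: (mulIf e0); rewrite divfK// sim_lastN.
  have -> : sim_coef z p = alpha%:C * e / (c - 1) by rewrite -E0 mulfK.
  by rewrite rmorphM/=; field.
have Ey : (sim z p.+1 (firstN k v) - z`_p) / e = (beta * mu ^+ k)%:C * (v / c).
  apply: (mulIf e0); rewrite divfK// sim_firstN.
  have -> : sim_coef z p.+1 = beta%:C * e / c by rewrite -E1 mulfK.
  by rewrite rmorphM/=; field.
have -> : modulus (sim z p (lastN n w) - sim z p.+1 (firstN k v)) =
    modulus ((sim z p (lastN n w) - z`_p) / e - (sim z p.+1 (firstN k v) - z`_p) / e).
  rewrite -mulrBl normcM normcV e1 invr1 mulr1; congr modulus; ring.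
apply: le_trans (normc_Im _); apply: le_trans (ler_norm _).
have ImB x y : complex.Im (x - y) = complex.Im x - complex.Im y by case: x; case: y.
rewrite ImB Ex Ey !ImRl !Im_div [modulus (c - 1)]normc_distC.
have -> : complex.Im (w - 1) * complex.Re (c - 1) - complex.Re (w - 1) * complex.Im (c - 1)
    = side1 c w.
  by rewrite /side1; case: (w) (c) => a b [a' b'] /=; ring.
have -> : complex.Im v * complex.Re c - complex.Re v * complex.Im c = - side0 c v.
  by rewrite /side0; ring.
rewrite le_eqVlt; apply/orP; left; apply/eqP; field.
by rewrite !gt_eqF.
Qed.

(** Copies of [S_l] are stripped off until another piece is met; this must stop, as [S_l^n(Lam)]
    shrinks to 1. *)
Lemma last_decomposition x : Lam x -> x != 1 -> exists n w,
  [/\ x = lastN n w, Lam w & exists j v, [/\ (1 <= j)%N, (j < l)%N, Lam v & w = sim z j v]].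
Proof.
move=> Lx x1.
have [|N HN] := lastN_near z_0 z_l Im_zq basic attr 0 (e := modulus (1 - x)).
  by rewrite normc_gt0 subr_eq0 eq_sym.
apply: contrapT => none.
suff [v [Lv xv]] : exists v, Lam v /\ x = lastN N v.
  by have := HN v Lv; rewrite -xv ltxx.
elim: (N) => [|n [v [Lv xv]]]; first by exists x.
have [j [jl [u Lu uv]]] := attractor_cover attr Lv.
have [jE|jn] := eqVneq j l.
  by exists u; split => //; rewrite xv -uv jE; exact/esym/iterSr.
case: none; exists n, v; split => //; exists j, u; split => //.
- by case/andP: jl.
- by rewrite ltn_neqAle jn; case/andP: jl.
Qed.

Lemma firstN_near (e : R) : 0 < e -> exists n, forall v, Lam v ->
  modulus (firstN n v) < e.
Proof.
move=> e0; have [_ cL _] := attr; have [B B0 LB] := compact_normc_bounded cL.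
have /andP[r0 r1] := sim_contractive basic l1.
have [N HN] : exists N, forall n, (N <= n)%N -> mu ^+ n < e / B.
  by apply: expr_small; rewrite ?(ltW r0)// divr_gt0.
exists N => v Lv.
rewrite (firstNE z_0 z_l basic) normcM normc_real ger0_norm ?exprn_ge0 ?(ltW mu0)//.
have := HN N (leqnn _); rewrite ltr_pdivlMr//; apply: le_lt_trans.
by rewrite ler_wpM2l ?exprn_ge0 ?(ltW mu0)// LB.
Qed.

Lemma first_decomposition x : Lam x -> x != 0 -> exists n w,
  [/\ x = firstN n w, Lam w & exists j v, [/\ (1 < j)%N, (j <= l)%N, Lam v & w = sim z j v]].
Proof.
move=> Lx x0.
have [|N HN] := firstN_near (e := modulus x); first by rewrite normc_gt0.
apply: contrapT => none.
suff [v [Lv xv]] : exists v, Lam v /\ x = firstN N v.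
  by have := HN v Lv; rewrite -xv ltxx.
elim: (N) => [|n [v [Lv xv]]]; first by exists x.
have [j [jl [u Lu uv]]] := attractor_cover attr Lv.
have [jE|jn] := eqVneq j 1%N.
  by exists u; split => //; rewrite xv -uv jE; exact/esym/iterSr.
case: none; exists n, v; split => //; exists j, u; split => //.
- by rewrite ltn_neqAle eq_sym jn; case/andP: jl.
- by case/andP: jl.
Qed.

Let T_mem w : Lam w -> triangle 0 1 c w.
Proof. exact: (attractor_triangle z_0 z_l Im_zq basic attr). Qed.

(* The error term only serves the end point 1, which lies in every S_l^n(Lam). *)
Lemma last_approx : exists2 K : R, 0 < K & forall x (e : R), Lam x -> 0 < e ->
  exists n w, [/\ x = lastN n w, Lam w &
    lam ^+ n * modulus (w - c) <= K * (lam ^+ n * side1 c w) + e].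
Proof.
have [_ eta20] := eta_gt0.
have [k k0 Hk] := side1_cone z_0 z_l Im_zq basic eta20.
exists k^-1 => [|x e Lx e0]; first by rewrite invr_gt0.
have [->|x1] := eqVneq x 1.
  have /andP[r0 r1] := sim_contractive basic ll.
  have [N HN] : exists N, forall n, (N <= n)%N -> lam ^+ n < e / modulus (1 - c).
    by apply: expr_small; rewrite ?(ltW r0)// divr_gt0.
  exists N, 1; split; last 2 first.
  - exact: (Lam1 gh).
  - rewrite /side1 /= subrr mulr0 mulr0 subr0 mulr0 mulr0 add0r.
    by rewrite -ler_pdivlMr// ltW// HN.
  - apply/eqP; rewrite eq_sym -subr_eq0.
    by rewrite (lastNE z_0 z_l basic) subrr mulr0.
have [n [w [xE Lw [j [v [j1 jl Lv wE]]]]]] := last_decomposition Lx x1.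
exists n, w; split => //; apply: ler_wpDr; first exact: ltW.
rewrite mulrCA ler_wpM2l ?exprn_ge0 ?(ltW lam0)// wE ler_pdivlMl//.
by apply: Hk => //; exact: T_mem.
Qed.

Lemma first_approx : exists2 K : R, 0 < K & forall x (e : R), Lam x -> 0 < e ->
  exists n w, [/\ x = firstN n w, Lam w &
    mu ^+ n * modulus (w - c) <= K * (mu ^+ n * side0 c w) + e].
Proof.
have [eta10 _] := eta_gt0.
have [k k0 Hk] := side0_cone z_0 z_l Im_zq basic eta10.
exists k^-1 => [|x e Lx e0]; first by rewrite invr_gt0.
have [->|x0] := eqVneq x 0.
  have /andP[r0 r1] := sim_contractive basic l1.
  have [N HN] : exists N, forall n, (N <= n)%N -> mu ^+ n < e / modulus c.
    by apply: expr_small; rewrite ?(ltW r0)// divr_gt0.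
  exists N, 0; split; last 2 first.
  - exact: (Lam0 gh).
  - rewrite /side0 /= !mulr0 subr0 !mulr0 !add0r normcN.
    by rewrite -ler_pdivlMr// ltW// HN.
  - by rewrite (firstNE z_0 z_l basic) mulr0.
have [n [w [xE Lw [j [v [j1 jl Lv wE]]]]]] := first_decomposition Lx x0.
exists n, w; split => //; apply: ler_wpDr; first exact: ltW.
rewrite mulrCA ler_wpM2l ?exprn_ge0 ?(ltW mu0)// wE ler_pdivlMl//.
by apply: Hk => //; exact: T_mem.
Qed.

(** Distinctness of the two points supplies the positive error that the approximations ask for. *)
Lemma apex_dist_le : exists2 C : R, 0 < C & forall x y, Lam x -> Lam y ->
  sim z p x != sim z p.+1 y ->
  exists n k w v, [/\ x = lastN n w, y = firstN k v, Lam w, Lam v &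
    `|alpha * lam ^+ n - beta * mu ^+ k| <=
    C * modulus (sim z p x - sim z p.+1 y)].
Proof.
have [K1 K10 H1] := last_approx; have [K0 K00 H0] := first_approx.
(* The triangle inequality runs through both points: 3 counts their distance [d] and the two errors,
   each scaled to [d]. *)
exists (K1 * modulus (1 - c) + K0 * modulus c + 3).
  by rewrite !addr_gt0 ?mulr_gt0.
move=> x y Lx Ly; rewrite -subr_eq0 -normc_gt0.
set d := modulus (_ - _) => d0.
(* Applying [S_p] multiplies the error [d / ratio p] back to [d]. *)
have [n [w [xE Lw wx]]] := H1 x _ Lx (divr_gt0 d0 rp0).
have [k [v [yE Lv vy]]] := H0 y _ Ly (divr_gt0 d0 rp10).
exists n, k, w, v; split => //.
have trans := transversal_dist n k w v; rewrite -xE -yE -/d in trans.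
have /(triangleP Im_zq)[_ sw _] := T_mem Lw.
have /(triangleP Im_zq)[sv _ _] := T_mem Lv.
pose A := ratio p * lam ^+ n * side1 c w / modulus (1 - c).
pose B := ratio p.+1 * mu ^+ k * side0 c v / modulus c.
have A0 : 0 <= A by rewrite /A !mulr_ge0 ?exprn_ge0 ?invr_ge0 ?normc_ge0.
have B0 : 0 <= B by rewrite /B !mulr_ge0 ?exprn_ge0 ?invr_ge0 ?normc_ge0.
rewrite -/A -/B in trans.
have Px : modulus (sim z p (lastN n c) - sim z p x) <= K1 * modulus (1 - c) * A + d.
  rewrite (sim_dist z_0) xE.
  have -> : lastN n c - lastN n w = (lastN n c - 1) - (lastN n w - 1) by ring.
  rewrite !(lastNE z_0 z_l basic) -mulrBr.
  have -> : c - 1 - (w - 1) = c - w by ring.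
  rewrite normcM normc_real ger0_norm ?exprn_ge0 ?(ltW lam0)// normc_distC.
  have := ler_wpM2l (ltW rp0) wx.
  have -> : K1 * modulus (1 - c) * A = ratio p * (K1 * (lam ^+ n * side1 c w)).
    by rewrite /A; field; rewrite gt_eqF.
  by rewrite [ratio p * (_ + _)]mulrDr mulrC [ratio p * (d / _)]mulrC divfK ?gt_eqF// mulrC.
have Qy : modulus (sim z p.+1 y - sim z p.+1 (firstN k c)) <= K0 * modulus c * B + d.
  rewrite (sim_dist z_0) yE !(firstNE z_0 z_l basic) -mulrBr.
  rewrite normcM normc_real ger0_norm ?exprn_ge0 ?(ltW mu0)//.
  have := ler_wpM2l (ltW rp10) vy.
  have -> : K0 * modulus c * B = ratio p.+1 * (K0 * (mu ^+ k * side0 c v)).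
    by rewrite /B; field; rewrite gt_eqF.
  by rewrite [ratio p.+1 * (_ + _)]mulrDr mulrC [ratio p.+1 * (d / _)]mulrC divfK ?gt_eqF// mulrC.
rewrite -apex_dist.
apply: le_trans (normc_distD (sim z p x) _ _) _.
apply: le_trans (lerD Px (normc_distD (sim z p.+1 y) _ _)) _.
apply: le_trans (lerD (lexx _) (lerD (lexx _) Qy)) _; rewrite -/d.
have KA : K1 * modulus (1 - c) * A <= K1 * modulus (1 - c) * d.
  by rewrite ler_wpM2l ?mulr_ge0 ?(ltW K10) ?(ltW Nc1)//; lra.
have KB : K0 * modulus c * B <= K0 * modulus c * d.
  by rewrite ler_wpM2l ?mulr_ge0 ?(ltW K00) ?(ltW Nc0)//; lra.
lra.
Qed.

(** The subarcs on both sides of [z_p] are [S_p(Lam)] and [S_(p+1)(Lam)], so preimages can replace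
    the order conditions. *)
Lemma condition_W_pieces : condition_W z Lam s p <->
  forall eps : R, 0 < eps -> exists2 d : R, 0 < d & forall x y, Lam x -> Lam y ->
    modulus (sim z p x - sim z p.+1 y) < d ->
    `|mass (below (sim z p x)) - mass (below (sim z p.+1 y))| <=
    eps * modulus (sim z p x - sim z p.+1 y).
Proof.
have fE x : Lam x ->
    hausdorff_measure s (subarc z`_0 z`_l Lam z`_0 x) = (mass (below x))%:E.
  by move=> Lx; rewrite z_0 z_l (subarc_below gh)// (arc_massE H_lty)// => w [].
have leP x y : arc_le z`_0 z`_l Lam x y <-> [/\ Lam x, Lam y & h x <= h y].
  by rewrite z_0 z_l; exact: (arc_leP gh).
have stab j w : (1 <= j <= l)%N -> Lam w -> Lam (sim z j w).
  exact: attractor_stable.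
have vert j : (j <= l)%N -> Lam z`_j by exact: (vertex_mem z_0 z_l attr gh).
have bounds j w (jl : (1 <= j <= l)%N) : Lam w ->
    h z`_j.-1 <= h (sim z j w) <= h z`_j.
  exact: (sim_coord_bounds z_0 z_l Im_zq basic attr gh s_gt0 moran H_gt0 H_lty).
have piece j w (jl : (1 <= j <= l)%N) : Lam w ->
    h z`_j.-1 <= h w <= h z`_j -> (sim z j @` Lam) w.
  exact: (coord_in_piece z_0 z_l Im_zq basic attr gh s_gt0 moran H_gt0 H_lty).
have Lp : Lam z`_p by apply/vert/ltnW.
have Lp1 : Lam z`_p.+1 by exact: vert.
have Lp0 : Lam z`_p.-1 by apply: vert; rewrite (leq_trans (leq_pred _))// ltnW.
split=> [H eps eps0|H le f eps eps0]; have [d d0 Hd] := H eps eps0;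
  exists d => // x y Lx Ly.
- have LSx := stab _ _ pl Lx; have LSy := stab _ _ pl1 Ly => xy.
  have /andP[x1 x2] := bounds _ _ pl Lx; have /andP[y1 y2] := bounds _ _ pl1 Ly.
  have := Hd _ _ LSx LSy; rewrite !fE// -EFinB abse_EFin lee_fin; apply => //;
    by apply/leP.
- rewrite /le /f => /leP[_ _ x1] /leP[_ _ x2] /leP[_ _ y1] /leP[_ _ y2] xy.
  have [|x' Lx' xE] := piece _ _ pl Lx; first by rewrite x1.
  have [|y' Ly' yE] := piece _ _ pl1 Ly; first by rewrite y1.
  rewrite !fE// -EFinB abse_EFin lee_fin -xE -yE; apply: Hd => //.
  by rewrite xE yE.
Qed.

(** With [powRD_ge], this trades the power of a sum for a sum of powers up to constants, for [s] on
    either side of 1. *)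
Lemma powRD_le (a b : R) : 0 <= a -> 0 <= b ->
  (a + b) `^ s <= 2 `^ s * (a `^ s + b `^ s).
Proof.
move=> a0 b0; wlog ab : a b a0 b0 / a <= b.
  move=> W; have [ab|/ltW ab] := leP a b; first exact: W.
  by rewrite addrC [X in _ * X]addrC; exact: W.
apply: (@le_trans _ _ ((2 * b) `^ s)).
  by rewrite ge0_ler_powR ?nnegrE ?addr_ge0 ?mulr_ge0// ?(ltW s_gt0)//; lra.
by rewrite powRM// ler_wpM2l ?powR_ge0// lerDr powR_ge0.
Qed.

Lemma powRD_ge (a b : R) : 0 <= a -> 0 <= b ->
  a `^ s + b `^ s <= 2 * (a + b) `^ s.
Proof.
move=> a0 b0; have -> : 2 * (a + b) `^ s = (a + b) `^ s + (a + b) `^ s by ring.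
by apply: lerD; rewrite ge0_ler_powR ?nnegrE ?addr_ge0 ?(ltW s_gt0)// ?lerDl ?lerDr.
Qed.

Lemma apex_mass_gap : exists2 kappa : R, 0 < kappa & forall n k,
  kappa * (lam ^+ n + mu ^+ k) `^ s <=
  `|mass (below (sim z p (lastN n c))) - mass (below (sim z p.+1 (firstN k c)))|.
Proof.
have Lc := apex_mem z_0 z_l Im_zq basic attr gh.
have below_pos := arc_comass_below_apex z_0 z_l Im_zq basic attr gh s_gt0 moran H_gt0 H_lty.
have above_pos := arc_comass_above_apex z_0 z_l Im_zq basic attr gh s_gt0 moran H_gt0 H_lty.
pose k1 := ratio p `^ s * arc_comass Lam s (below c).
pose k2 := ratio p.+1 `^ s * arc_comass Lam s (above Lam h c).
have k10 : 0 < k1 by rewrite mulr_gt0 ?powR_gt0.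
have k20 : 0 < k2 by rewrite mulr_gt0 ?powR_gt0.
pose m := Num.min k1 k2.
have m0 : 0 < m by rewrite lt_min k10.
have m1 : m <= k1 by rewrite ge_min lexx.
have m2 : m <= k2 by rewrite ge_min lexx orbT.
have t0 : 0 < 2 `^ s :> R by rewrite powR_gt0.
(* The 2 comes from adding the bounds for the two cylinders, and the power of 2 from [powRD_le]. *)
exists (m / (2 * 2 `^ s)) => [|n k]; first by rewrite divr_gt0 ?mulr_gt0.
have Ln := lastN_stable z_0 z_l Im_zq basic attr n Lc.
have Lk := firstN_stable z_0 z_l Im_zq basic attr k Lc.
have [gap1 gap2] := arc_mass_gap z_0 z_l Im_zq basic attr gh s_gt0 moran H_gt0 H_lty
  p_gt0 p_ltl Ln Lk.
have b1 := arc_comass_below_lastN z_0 z_l Im_zq basic attr gh s_gt0 moran H_gt0 H_lty n.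
have a1 := arc_comass_above_firstN z_0 z_l Im_zq basic attr gh s_gt0 moran H_gt0 H_lty k.
set G := mass (below (sim z p.+1 _)) - _ in gap1 gap2 *.
rewrite distrC -/G; apply: le_trans (ler_norm _).
have la0 : 0 <= lam ^+ n by rewrite exprn_ge0 ?ltW.
have mk0 : 0 <= mu ^+ k by rewrite exprn_ge0 ?ltW.
have i1 : m * (lam ^+ n) `^ s <= G.
  apply: le_trans gap1; apply: le_trans (ler_wpM2l (powR_ge0 _ _) b1).
  by rewrite mulrCA mulrC ler_wpM2l ?powR_ge0.
have i2 : m * (mu ^+ k) `^ s <= G.
  apply: le_trans gap2; apply: le_trans (ler_wpM2l (powR_ge0 _ _) a1).
  by rewrite mulrCA mulrC ler_wpM2l ?powR_ge0.
rewrite mulrAC ler_pdivrMr ?mulr_gt0//.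
apply: le_trans (ler_wpM2l (ltW m0) (powRD_le la0 mk0)) _.
rewrite mulrCA mulrDr [2 * _]mulrC mulrCA ler_pM2l//.
by rewrite mulr2n mulrDr mulr1 lerD.
Qed.

End ContactAngle.

Theorem proposition6p5 (R : realType) (l : nat) (z : l.+1.-tuple R[i])
    (q : nat) (Lam : set R[i]) (s : R) (p : nat)
    (hz0 : z`_0 = 0) (hzl : z`_l = 1) (hzq : 0 < complex.Im z`_q)
    (hLam : regular_self_similar_arc z q Lam)
    (hs : hausdorff_dim Lam = s%:E)
    (hp : (1 <= p <= l.-1)%N)
    (htheta : corner_angle z q p = 0) :
  condition_W z Lam s p <->
  little_o_condition
    (sim_ratio z p * modulus (1 - z`_q))
    (sim_ratio z p.+1 * modulus z`_q)
    (sim_ratio z l) (sim_ratio z 1) s.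
Proof.
case: hLam => basic [attr [g hg]] char0.
rewrite hz0 hzl in hg.
have [h gh] : exists h, arc_coord Lam 0 1 g h.
  by case: (hg) => _ _ [h [ch ghK]] _ _; exists h.
have [s0 moran H0 Hoo] := attractor_hausdorff hz0 hzl hzq basic attr hs.
case/andP: hp => p1 pl'.
have pl : (p < l)%N by rewrite (leq_ltn_trans pl')// ltn_predL (l_gt0 hz0 hzl hzq basic).
apply: iff_trans (condition_W_pieces hz0 hzl hzq basic attr gh s0 moran H0 Hoo p1 pl) _.
have dist_apex := apex_dist hz0 hzl hzq basic p1 pl htheta.
split=> H eps eps0.
- have [k k0 Hk] := apex_mass_gap hz0 hzl hzq basic attr gh s0 moran H0 Hoo p1 pl.
  (* [eps * k] offsets the constant of [apex_mass_gap]; the threshold is unchanged because the two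
     test points are exactly at the distance in question. *)
  have [d d0 Hd] := H _ (mulr_gt0 eps0 k0); exists d => // i j ij.
  have Lc := apex_mem hz0 hzl hzq basic attr gh.
  have Li := lastN_stable hz0 hzl hzq basic attr i Lc.
  have Lj := firstN_stable hz0 hzl hzq basic attr j Lc.
  have := Hd _ _ Li Lj; rewrite dist_apex => /(_ ij) /(le_trans (Hk i j)).
  by move=> le_ij; rewrite -(ler_pM2l k0) mulrA [k * eps]mulrC.
- have [C C0 HC] := apex_dist_le hz0 hzl hzq basic attr gh p1 pl htheta char0.
  pose M := arc_mass s Lam.
  have M0 : 0 < M by exact: arc_mass_gt0.
  (* The 2 is that of [powRD_ge], [M] the factor in [arc_mass_gap_le], and [C] the loss in passing
     from the two points to the apex images. *)
  have [|d d0 Hd] := H (eps / (2 * M * C)); first by rewrite divr_gt0 ?mulr_gt0.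
  exists (d / C) => [|x y Lx Ly]; first by rewrite divr_gt0.
  rewrite ltr_pdivlMr// mulrC => xyd.
  (* Coinciding points, such as both at [z_p], make both sides vanish and are outside the scope of
     [apex_dist_le]. *)
  have [xy|xy] := eqVneq (sim z p x) (sim z p.+1 y).
    by rewrite xy !subrr normr0 normc0 mulr0.
  have [i [j [w [v [xE yE Lw Lv le_ij]]]]] := HC x y Lx Ly xy.
  have gap := arc_mass_gap_le hz0 hzl hzq basic attr gh s0 moran H0 Hoo i j p1 pl Lw Lv.
  rewrite -xE -yE in gap; apply: le_trans gap _; rewrite -/M.
  have la0 : 0 <= sim_ratio z l ^+ i by rewrite exprn_ge0 ?normc_ge0.
  have mj0 : 0 <= sim_ratio z 1 ^+ j by rewrite exprn_ge0 ?normc_ge0.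
  have o_ij := Hd i j (le_lt_trans le_ij xyd).
  apply: le_trans (ler_wpM2r (ltW M0) (powRD_ge s0 la0 mj0)) _.
  apply: le_trans (ler_wpM2r (ltW M0) (ler_wpM2l (ler0n _ 2) o_ij)) _.
  have e20 : 0 <= eps / (2 * M * C) by rewrite divr_ge0 ?mulr_ge0 ?ltW.
  apply: le_trans (ler_wpM2r (ltW M0) (ler_wpM2l (ler0n _ 2) (ler_wpM2l e20 le_ij))) _.
  rewrite le_eqVlt; apply/orP; left; apply/eqP; field.
  by rewrite !gt_eqF.
Qed.
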